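(* Let $f\in\mathcal{U}$, let $y\in\mathcal{Y}_F$ be a minimizer of the atomistic total energy $\Phi^{total}(y)=\Phi(y)-\langle f,y\rangle$, and let $\underline{A}:=\min_\xi A_\xi(y)$. Assume that $\underline{A}>0$ and that $\min_\xi y'_\xi\ge\frac{r^*}{2}>0$. Let $\gamma$ be a blending function, $\Phi^{total}_\gamma(y):=\Phi^{qce}_\gamma(y)-\langle f,y\rangle$, $\alpha_\xi:=\frac{\gamma_\xi+\gamma_{\xi-1}}{2}$, $\beta_\xi:=1-\frac{\gamma_{\xi+1}+\gamma_{\xi-1}}{2}$, and $\bar C_i:=C_i(2\min_\xi y'_\xi)$ for $i=1,\dots,4$. There exist constants $\delta_1=\delta_1(\underline{A})>0$ and $\delta_2=\delta_2(\min_\xi y'_\xi,\underline{A},\bar C_1,\bar C_2,\bar C_3,\gamma)>0$, depending only on the indicated quantities, such that if $$2\bar C_2\|\Delta^2\alpha_\xi\|_{\ell^\infty}+2\varepsilon\bar C_3\|\Delta\beta_\xi\,y''_\xi\|_{\ell^\infty}+2\varepsilon^2\left\{\bar C_3\|(1-\beta_{\xi-1})y'''_\xi\|_{\ell^\infty}+\bar C_4\|(1-\beta_\xi)(y''_\xi)^2\|_{\ell^\infty}\right\}\le\delta_1$$ and $$\varepsilon^{-\frac12}\bar C_1\|\Delta^2\alpha_\xi\|_{\ell^2_\varepsilon}+\varepsilon^{\frac12}\bar C_2\|\Delta\beta_\xi\,y''_\xi\|_{\ell^2_\varepsilon}+\varepsilon^{\frac32}\left\{\bar C_2\|(1-\beta_{\xi-1})y'''_\xi\|_{\ell^2_\varepsilon}+\bar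 C_3\|(1-\beta_\xi)(y''_\xi)^2\|_{\ell^2_\varepsilon}\right\}\le\delta_2,$$ then there exists a locally unique minimizer $y_\gamma\in\mathcal{Y}_F$ of $\Phi^{total}_\gamma$ which satisfies $$\|y-y_\gamma\|_{\mathcal{U}^{1,2}}\le\frac{4}{\underline{A}}\left[\bar C_1\|\Delta^2\alpha_\xi\|_{\ell^2_\varepsilon}+\varepsilon\bar C_2\|\Delta\beta_\xi\,y''_\xi\|_{\ell^2_\varepsilon}+\varepsilon^2\left\{\bar C_2\|(1-\beta_{\xi-1})y'''_\xi\|_{\ell^2_\varepsilon}+\bar C_3\|(1-\beta_\xi)(y''_\xi)^2\|_{\ell^2_\varepsilon}\right\}\right].$$
   Context: Let $N\in\mathbb{N}$, $\varepsilon=1/N$ and $F\in(0,\infty)$. Let $\mathcal{U}$ be the space of $u:\mathbb{Z}\to\mathbb{R}$ with $u_{\xi+N}=u_\xi$ for all $\xi$ and $\sum_{\xi=1}^N u_\xi=0$, and let $\mathcal{Y}_F$ be the set of $y:\mathbb{Z}\to\mathbb{R}$ of the form $y_\xi=F\varepsilon\xi+u_\xi$ with $u\in\mathcal{U}$. Write $\langle f,v\rangle=\varepsilon\sum_{\xi=1}^N f_\xi v_\xi$. Differences: $\Delta v_\xi=v_\xi-v_{\xi-1}$, $\Delta^2v_\xi=v_{\xi+1}-2v_\xi+v_{\xi-1}$, $v'_\xi=\frac{v_\xi-v_{\xi-1}}{\varepsilon}$, $v''_\xi=\frac{v_{\xi+1}-2v_\xi+v_{\xi-1}}{\varepsilon^2}$,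 $v'''_\xi=\frac{v_{\xi+1}-3v_\xi+3v_{\xi-1}-v_{\xi-2}}{\varepsilon^3}$. In a product such as $\Delta\beta_\xi\,y''_\xi$, $\Delta$ acts only on $\beta$. For $N$-periodic $v$, $\|v\|_{\ell^\infty}=\max_{1\le\xi\le N}|v_\xi|$ and $\|v\|_{\ell^2_\varepsilon}=(\varepsilon\sum_{\xi=1}^N|v_\xi|^2)^{1/2}$; and $\|u\|_{\mathcal{U}^{1,2}}=\|u'\|_{\ell^2_\varepsilon}$. Potential (fixed): $\phi\in C^4((0,\infty],\mathbb{R})$; there is $r^*>0$ with $\phi''(r)>0$ for $r\in(0,r^* )$ and $\phi''(r)<0$ for $r\in(r^*,\infty)$; $\phi$ and its derivatives decay at infinity. $C_i(r_0):=\sup_{r\ge r_0}|\phi^{(i)}(r)|$ for $i=1,\dots,4$. Energies (for $y\in\mathcal{Y}_F$ with $y'_\xi>0$ for all $\xi$). Atomistic energy: $$\Phi(y)=\varepsilon\sum_{\xi=1}^N\{\phi(y'_\xi)+\phi(y'_\xi+y'_{\xi+1})\}.$$ BQCE energy with $N$-periodic blending function $\gamma:\mathbb{Z}\to[0,1]$: $$\Phi^{qce}_\gamma(y)=\varepsilon\sum_{\xi=1}^N\Big\{\phi(y'_\xi)+\tfrac{\gamma_\xi}{2}\{\phi(2y'_\xi)+\phi(2y'_{\xi+1})\}+\tfrac{1-\gamma_\xi}{2}\{\phi(y'_{\xi-1}+y'_\xi)+\phi(y'_{\xi+1}+y'_{\xi+2})\}\Big\}.$$ $A_\xi(y):=\phi''(y'_\xi)+2\phi''(y'_\xi+y'_{\xi+1})+2\phi''(y'_{\xi-1}+y'_\xi)$.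 A ''locally unique minimizer'' is a local minimizer (on $\mathcal{Y}_F$) that is the only local minimizer in some neighbourhood of itself. *)

(* Defs.v *)
From HB Require Import structures.
From mathcomp Require Import all_boot all_order all_algebra.
From mathcomp Require Import all_classical all_reals all_analysis.

Set Implicit Arguments.
Unset Strict Implicit.
Unset Printing Implicit Defensive.

Import Order.TTheory GRing.Theory Num.Theory.
Import numFieldNormedType.Exports.

Local Open Scope classical_set_scope.
Local Open Scope ring_scope.

Definition eps (R : realType) (N : nat) : R := N%:R^-1.

Definition periodic (R : realType) (N : nat) (v : int -> R) : Prop :=
  forall xi : int, v (xi + N%:Z) = v xi.

Definition spaceU (R : realType) (N : nat) (u : int -> R) : Prop :=
  periodic N u /\ \sum_(1 <= k < N.+1) u k%:Z = 0.

Definition spaceY (R : realType) (N : nat) (F : R) (y : int -> R) : Prop :=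
  exists2 u, spaceU N u & forall xi, y xi = F * eps R N * xi%:~R + u xi.

Definition blending (R : realType) (N : nat) (gamma : int -> R) : Prop :=
  periodic N gamma /\ forall xi, 0 <= gamma xi <= 1.

Definition pairing (R : realType) (N : nat) (f v : int -> R) : R :=
  eps R N * \sum_(1 <= k < N.+1) f k%:Z * v k%:Z.

(* Unscaled differences (Delta, Delta^2), then the eps-scaled difference
   quotients (v', v'', v'''). *)
Definition Delta (R : realType) (v : int -> R) (xi : int) : R :=
  v xi - v (xi - 1).

Definition Delta2 (R : realType) (v : int -> R) (xi : int) : R :=
  v (xi + 1) - 2 * v xi + v (xi - 1).

Definition D1 (R : realType) (N : nat) (v : int -> R) (xi : int) : R :=
  (v xi - v (xi - 1)) / eps R N.

Definition D2 (R : realType) (N : nat) (v : int -> R) (xi : int) : R :=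
  (v (xi + 1) - 2 * v xi + v (xi - 1)) / eps R N ^+ 2.

Definition D3 (R : realType) (N : nat) (v : int -> R) (xi : int) : R :=
  (v (xi + 1) - 3 * v xi + 3 * v (xi - 1) - v (xi - 2)) / eps R N ^+ 3.

(* All entries are nonnegative, so the neutral element 0 does not affect the
   maximum. *)
Definition norm_inf (R : realType) (N : nat) (v : int -> R) : R :=
  \big[Num.max/0]_(1 <= k < N.+1) `|v k%:Z|.

Definition norm_l2 (R : realType) (N : nat) (v : int -> R) : R :=
  Num.sqrt (eps R N * \sum_(1 <= k < N.+1) `|v k%:Z| ^+ 2).

Definition norm_U12 (R : realType) (N : nat) (u : int -> R) : R :=
  norm_l2 N (D1 N u).

(* Minimum over one period of an N-periodic function; seeded with the value
   at 1, which belongs to the range as soon as N > 0. *)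
Definition min_period (R : realType) (N : nat) (v : int -> R) : R :=
  \big[Num.min/v 1]_(1 <= k < N.+1) v k%:Z.

(* A potential on (0, +oo] is represented by a total function on R, of which
   only the values on (0, +oo) matter; being C^4 up to +oo, with decay there,
   is the last clause. *)
Definition potential (R : realType) (phi : R -> R) (rstar : R) : Prop :=
  [/\ (forall i r, (i < 4)%N -> 0 < r -> derivable (derive1n i phi) r 1)
      /\ (forall r, 0 < r -> {for r, continuous (derive1n 4 phi)}),
      0 < rstar,
      forall r, 0 < r -> r < rstar -> 0 < derive1n 2 phi r,
      forall r, rstar < r -> derive1n 2 phi r < 0
    & forall i, (i <= 4)%N -> derive1n i phi r @[r --> +oo] --> (0 : R)].

Definition Csup (R : realType) (phi : R -> R) (i : nat) (r0 : R) : R :=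
  sup [set `|derive1n i phi r| | r in [set r | r0 <= r]].

Definition PhiA (R : realType) (phi : R -> R) (N : nat) (y : int -> R) : R :=
  eps R N * \sum_(1 <= k < N.+1)
    (phi (D1 N y k%:Z) + phi (D1 N y k%:Z + D1 N y (k%:Z + 1))).

Definition PhiQCE (R : realType) (phi : R -> R) (N : nat) (gamma : int -> R)
    (y : int -> R) : R :=
  eps R N * \sum_(1 <= k < N.+1)
    (phi (D1 N y k%:Z)
     + gamma k%:Z / 2 *
         (phi (2 * D1 N y k%:Z) + phi (2 * D1 N y (k%:Z + 1)))
     + (1 - gamma k%:Z) / 2 *
         (phi (D1 N y (k%:Z - 1) + D1 N y k%:Z)
          + phi (D1 N y (k%:Z + 1) + D1 N y (k%:Z + 2)))).

Definition PhiA_total (R : realType) (phi : R -> R) (N : nat)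
    (f y : int -> R) : R :=
  PhiA phi N y - pairing N f y.

Definition PhiQCE_total (R : realType) (phi : R -> R) (N : nat)
    (gamma f y : int -> R) : R :=
  PhiQCE phi N gamma y - pairing N f y.

Definition Acoef (R : realType) (phi : R -> R) (N : nat) (y : int -> R)
    (xi : int) : R :=
  derive1n 2 phi (D1 N y xi) + 2 * derive1n 2 phi (D1 N y xi + D1 N y (xi + 1))
  + 2 * derive1n 2 phi (D1 N y (xi - 1) + D1 N y xi).

Definition alpha (R : realType) (gamma : int -> R) (xi : int) : R :=
  (gamma xi + gamma (xi - 1)) / 2.

Definition beta (R : realType) (gamma : int -> R) (xi : int) : R :=
  1 - (gamma (xi + 1) + gamma (xi - 1)) / 2.

(* The energies are only meaningful on the deformations with y' > 0. *)
Definition deformation (R : realType) (N : nat) (F : R) (y : int -> R) : Prop :=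
  spaceY N F y /\ forall xi, 0 < D1 N y xi.

(* Y_F is a finite-dimensional affine space over U, on which norm_U12 is a
   norm; its balls are therefore a basis of neighbourhoods. *)
Definition local_minimizer (R : realType) (N : nat) (F : R)
    (E : (int -> R) -> R) (y : int -> R) : Prop :=
  deformation N F y /\
  exists2 rho : R, 0 < rho &
    forall z, deformation N F z -> norm_U12 N (z \- y) < rho -> E y <= E z.

Definition locally_unique_minimizer (R : realType) (N : nat) (F : R)
    (E : (int -> R) -> R) (y : int -> R) : Prop :=
  local_minimizer N F E y /\
  exists2 rho : R, 0 < rho &
    forall z, local_minimizer N F E z -> norm_U12 N (z \- y) < rho -> z = y.

(* Main.v *)
Require Import Defs.
From HB Require Import structures.
From mathcomp Require Import all_boot all_order all_algebra.
From mathcomp Require Import all_classical all_reals all_analysis.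
From mathcomp Require Import ring lra zify.

Set Implicit Arguments.
Unset Strict Implicit.
Unset Printing Implicit Defensive.

Import Order.TTheory GRing.Theory Num.Theory.
Import numFieldNormedType.Exports.
Import Defs.

Local Open Scope classical_set_scope.
Local Open Scope ring_scope.

(** The blended energy is compared with the atomistic one in the strain
    variables r = y'.  Collecting the second-neighbour bonds, both energies are
    instances of one functional with weights a on the terms phi(2 r_k) and b on
    the terms phi(r_k + r_(k+1)): the atomistic model has a = 0 and b = 1, the
    blended one a = alpha and b = beta ([PhiA_energy], [PhiQCE_energy]).

    Consistency.  The atomistic minimizer y makes the atomistic first variation
    equal to the load ([first_variation]).  The two first variations differ by
    the weighted mean of one quantity, [gap] phi'.  As the total weights of the
    two models differ by the second difference of alpha only, Taylor expansion
    around 2 r_k bounds that quantity by exactly the four terms of the error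
    estimate ([gap_bound], [denergy_gap_le]).

    Stability.  Beyond rstar, phi is concave, so the parallelogram inequality
    bounds the second variation from below by a diagonal form
    ([d2energy_ge]).  Its coefficients differ from A_k(y) by 2 [gap] phi'',
    which the same Taylor bound controls.  With delta1 = A / 4 the second
    variation at y is at least (3 A / 4) times the squared norm
    ([d2energy_gap_ge]).

    Existence.  The blended minimizer is found variationally.  On the box of
    deformations whose strains differ from y' by at most kappa, phi'' varies by
    a multiple of kappa, so a small kappa makes the blended energy strongly
    convex there, with constant A / 2 ([total_growth]).  Compactness gives a
    minimizer yg on the box ([box_minimizer]).  Comparing its energy with that
    of y gives (A / 4) n^2 <= residual * n for n the distance from y to yg,
    which is the error estimate.  The smallness condition on the residual
    carries a factor eps^(1/2), the one lost when the maximum norm of a strain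
    is bounded by its l^2 norm; hence yg lies in the interior of the box, is a
    local minimizer, and is the only one nearby by strong convexity
    ([qce_minimizer]).  The constant kappa depends on phi, on the minimal
    strain and on A alone, so the thresholds do not depend on N. *)

(** * Mean value estimates and the potential *)

Lemma MVT_between (R : realType) (g dg : R -> R) (a b : R) :
  (forall x, Num.min a b <= x <= Num.max a b -> is_derive x 1 g (dg x)) ->
  exists2 c, Num.min a b <= c <= Num.max a b & g b - g a = dg c * (b - a).
Proof.
wlog ab : a b / a <= b.
  move=> H hg; have /orP[ab|ba] := le_total a b; first exact: H.
  have [|c hc e] := H b a ba.
    by move=> x hx; apply: hg; rewrite minC maxC.
  by exists c; [rewrite minC maxC | rewrite -opprB e -mulrN opprB].
rewrite min_l// max_r// => hg.
have [||c hc e] := @MVT_segment R g dg a b ab.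
- by move=> x; rewrite in_itv/= => /andP[/ltW h1 /ltW h2]; apply: hg; rewrite h1.
- apply: continuous_in_subspaceT => x; rewrite inE/= in_itv/= => hx.
  by have := hg x hx => /@ex_derive /derivable1_diffP /differentiable_continuous.
- by exists c => //; move: hc; rewrite in_itv.
Qed.

Lemma lipschitz_between (R : realType) (g dg : R -> R) (a b M : R) :
  (forall x, Num.min a b <= x <= Num.max a b -> is_derive x 1 g (dg x)) ->
  (forall x, Num.min a b <= x <= Num.max a b -> `|dg x| <= M) ->
  `|g b - g a| <= M * `|b - a|.
Proof.
move=> hg hM; have [c hc ->] := MVT_between hg.
by rewrite normrM ler_wpM2r// hM.
Qed.

(** The quadratic term uses a reference coefficient q instead of the second
    derivative at a, so that one statement serves both for expanding an energy
    with the Hessian frozen at a base point (q = phi''(p)) and for first-order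
    remainders (q = 0).  The sign s treats the two bounds at once. *)
Lemma taylor_between (R : realType) (g dg : R -> R) (a b q w : R) :
  (forall x, Num.min a b <= x <= Num.max a b -> is_derive x 1 g (dg x)) ->
  (forall x, Num.min a b <= x <= Num.max a b ->
     `|dg x - dg a - q * (x - a)| <= w * `|x - a|) ->
  `|g b - g a - dg a * (b - a) - q * (b - a) ^+ 2 / 2|
     <= w * (b - a) ^+ 2 / 2.
Proof.
move=> hg hw.
suff H (s : R) : `|s| = 1 ->
    s * (g b - g a - dg a * (b - a) - q * (b - a) ^+ 2 / 2)
      <= w * (b - a) ^+ 2 / 2.
  rewrite ler_norml; apply/andP; split.
  - by have := H (-1) (normrN1 R); lra.
  - by have := H 1 (normr1 R); lra.
move=> hs.
(* h' is a nonpositive multiple of x - a, so h decreases away from a. *)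
pose h x := s * (g x - dg a * (x - a) - q / 2 * (x - a) ^+ 2)
            - w / 2 * (x - a) ^+ 2.
pose dh x := s * (dg x - dg a - q * (x - a)) - w * (x - a).
have hh x : Num.min a b <= x <= Num.max a b -> is_derive x 1 h (dh x).
  move=> /hg gx; rewrite /h /dh; apply: is_derive_eq.
  rewrite /GRing.scale/=; by field.
have [c hc e] := MVT_between hh.
have : dh c * (b - a) <= 0.
  have := hw _ hc; rewrite -[leLHS]mul1r -hs -normrM.
  set D := s * _ => hD.
  rewrite /dh -/D; move: hc; case: (leP a b) => [ab|/ltW ba] /andP[h1 h2].
    rewrite mulr_le0_ge0 ?subr_ge0//.
    move: hD; rewrite (ger0_norm (_ : 0 <= c - a)) ?subr_ge0// => /ler_normlP[_]; lra.
  - rewrite mulr_ge0_le0 ?subr_le0//.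
    move: hD; rewrite (ler0_norm (_ : c - a <= 0)) ?subr_le0// => /ler_normlP[]; lra.
rewrite -e /h; lra.
Qed.

Section Potential.
Variables (R : realType) (phi : R -> R) (rstar : R).
Hypothesis hphi : potential phi rstar.

Lemma potential_is_derive (i : nat) (r : R) :
  (i < 4)%N -> 0 < r -> is_derive r 1 (derive1n i phi) (derive1n i.+1 phi r).
Proof.
move=> i4 r0; have [[hd _] _ _ _ _] := hphi.
apply: DeriveDef; first exact: hd.
by rewrite /derive1n/= derive1E.
Qed.

Lemma potential_continuous (i : nat) (r : R) :
  (i <= 4)%N -> 0 < r -> {for r, continuous (derive1n i phi)}.
Proof.
move=> i4 r0; have [[hd hc] _ _ _ _] := hphi.
move: i4; rewrite leq_eqVlt => /predU1P[->|i4]; first exact: hc.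
exact/differentiable_continuous/derivable1_diffP/hd.
Qed.

(** The supremum defining [Csup] is taken over a bounded set: decay at
    infinity bounds the derivative on a half-line, continuity on the compact
    rest. *)
Lemma Csup_ge (i : nat) (r0 r : R) :
  (i <= 4)%N -> 0 < r0 -> r0 <= r -> `|derive1n i phi r| <= Csup phi i r0.
Proof.
move=> i4 r00 r0r; apply: ub_le_sup; last by exists r.
have [_ _ _ _ /(_ i i4) hl] := hphi.
have /cvgrPdist_le/(_ 1 ltr01) [M [_ HM]] := hl.
pose M' := Num.max r0 (M + 1).
have : compact (derive1n i phi @` `[r0, M']).
  apply: continuous_compact; last exact: segment_compact.
  apply: continuous_in_subspaceT => x; rewrite inE/= in_itv/= => /andP[h _].
  by apply: potential_continuous => //; apply: lt_le_trans h.
move=> /compact_bounded [B [_ HB]].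
exists (Num.max (B + 1) 1) => _ [x /= r0x <-].
have [xM|Mx] := leP x M'.
  rewrite le_max; apply/orP; left; apply: (HB (B + 1)); first by rewrite ltrDl.
  by exists x => //=; rewrite in_itv/= r0x.
rewrite le_max; apply/orP; right.
have := HM x; rewrite /= sub0r normrN; apply.
by move: Mx; rewrite /M' gt_max => /andP[_]; lra.
Qed.

Lemma Csup_ge0 (i : nat) (r0 : R) : (i <= 4)%N -> 0 < r0 -> 0 <= Csup phi i r0.
Proof. by move=> i4 r00; apply: le_trans (Csup_ge i4 r00 (lexx r0)). Qed.

(** The hypothesis hphi gives the strict sign for r > rstar only; the endpoint
    follows by continuity and is needed since 2 min y' may be equal to rstar. *)
Lemma potential_concave (r : R) : rstar <= r -> derive1n 2 phi r <= 0.
Proof.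
have [_ rs0 _ hneg _] := hphi.
rewrite le_eqVlt => /predU1P[<-|/hneg/ltW//].
rewrite leNgt; apply/negP => pos.
have /cvgrPdist_lt/(_ _ pos) := @potential_continuous 2 rstar isT rs0.
move=> /nbhs_ballP[d /= d0 /(_ (rstar + d / 2))].
have d2 : 0 < d / 2 by rewrite divr_gt0.
rewrite /ball/=; have -> : rstar - (rstar + d / 2) = - (d / 2) by lra.
have d2d : d / 2 < d by rewrite ltr_pdivrMr// ltr_pMr// ltr1n.
rewrite normrN (ger0_norm (ltW d2)) => /(_ d2d)/ltr_normlP[_].
rewrite gtrBl => pos'; have := hneg (rstar + d / 2).
by rewrite ltrDl => /(_ d2)/(lt_trans pos'); rewrite ltxx.
Qed.

End Potential.

(** * Periodic functions and their means over a period *)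

Lemma periodic_addn (R : realType) (N : nat) (v : int -> R) (xi n : int) :
  periodic N v -> v (xi + n * N%:Z) = v xi.
Proof.
move=> pv; elim: n => [|n ih|n ih]; first by rewrite mul0r addr0.
- by rewrite -addn1 PoszD mulrDl mul1r addrA pv.
- rewrite -{}ih -(pv (xi + - n.+1%:Z * N%:Z)); congr (v _).
  by rewrite -addrA; congr (_ + _); rewrite -addn1 PoszD; ring.
Qed.

Lemma periodic_repr (R : realType) (N : nat) (v : int -> R) (xi : int) :
  (0 < N)%N -> periodic N v -> exists2 k, (1 <= k < N.+1)%N & v xi = v k%:Z.
Proof.
move=> N0 pv; have NZ : N%:Z != 0 by lia.
have := modz_ge0 (xi - 1) NZ; have := @ltz_pmod (xi - 1) N%:Z.
have := divz_eq (xi - 1) N%:Z; set q := (_ %/ _)%Z; case: (_ %% _)%Z => // r e h _.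
exists r.+1; first by have := h; lia.
by rewrite -(periodic_addn r.+1 q pv); congr (v _); rewrite -addn1 PoszD; lia.
Qed.

Lemma le_norm_inf (R : realType) (N : nat) (v : int -> R) (xi : int) :
  (0 < N)%N -> periodic N v -> `|v xi| <= norm_inf N v.
Proof.
move=> N0 pv; have [k hk ->] := periodic_repr xi N0 pv.
by apply: (@le_bigmax_seq _ _ _ _ 0 k xpredT (fun k => `|v k%:Z|)) => //;
  rewrite mem_index_iota.
Qed.

Lemma min_period_le (R : realType) (N : nat) (v : int -> R) (xi : int) :
  (0 < N)%N -> periodic N v -> min_period N v <= v xi.
Proof.
move=> N0 pv; have [k hk ->] := periodic_repr xi N0 pv.
by apply: (@ge_bigmin_seq _ _ _ _ (v 1) k xpredT (fun k => v k%:Z)) => //;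
  rewrite mem_index_iota.
Qed.

Lemma min_period_gt0 (R : realType) (N : nat) (v : int -> R) :
  (forall xi, 0 < v xi) -> 0 < min_period N v.
Proof. by move=> v0; apply: lt_bigmin. Qed.

Definition mean (R : realType) (N : nat) (v : int -> R) : R :=
  eps R N * \sum_(1 <= k < N.+1) v k%:Z.

Section Mean.
Variables (R : realType) (N : nat).
Hypothesis N0 : (0 < N)%N.
Implicit Types v w : int -> R.

Lemma eps_gt0 : 0 < eps R N.
Proof. by rewrite invr_gt0 ltr0n. Qed.

Lemma epsN : eps R N * N%:R = 1.
Proof. by rewrite mulVf// pnatr_eq0; lia. Qed.

Lemma eq_mean v w : v =1 w -> mean N v = mean N w.
Proof. by move=> e; congr (_ * _); apply: eq_bigr. Qed.

Lemma meanD v w : mean N (fun k => v k + w k) = mean N v + mean N w.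
Proof. by rewrite /mean big_split mulrDr. Qed.

Lemma meanZ c v : mean N (fun k => c * v k) = c * mean N v.
Proof. by rewrite /mean mulrCA; congr (_ * _); rewrite mulr_sumr. Qed.

Lemma meanB v w : mean N (fun k => v k - w k) = mean N v - mean N w.
Proof. by rewrite /mean sumrB mulrBr. Qed.

Lemma le_mean v w : (forall k, v k <= w k) -> mean N v <= mean N w.
Proof.
by move=> h; rewrite /mean ler_wpM2l ?(ltW eps_gt0)//; apply: ler_sum => k _.
Qed.

Lemma mean_ge0 v : (forall k, 0 <= v k) -> 0 <= mean N v.
Proof. by move=> h; rewrite /mean mulr_ge0 ?(ltW eps_gt0)// sumr_ge0. Qed.

Lemma ler_norm_mean v w : (forall k, `|v k| <= w k) -> `|mean N v| <= mean N w.
Proof.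
move=> h; apply: (@le_trans _ _ (mean N (fun k => `|v k|))); last exact: le_mean.
by rewrite /mean normrM (ger0_norm (ltW eps_gt0)) ler_wpM2l ?(ltW eps_gt0)// ler_norm_sum.
Qed.

Lemma mean_shift v : periodic N v -> mean N (fun k => v (k + 1)) = mean N v.
Proof.
move=> pv; congr (_ * _).
have -> : \sum_(1 <= k < N.+1) v (k%:Z + 1) = \sum_(1 <= k < N.+1) v k.+1%:Z.
  by apply: eq_bigr => k _; rewrite -[k.+1]addn1 PoszD.
case: N N0 pv => // n _ pv.
rewrite big_nat_recr//= [RHS]big_nat_recl//= addrC; congr (_ + _).
by rewrite -[n.+2]add1n PoszD pv.
Qed.

Lemma mean_shiftN v : periodic N v -> mean N (fun k => v (k - 1)) = mean N v.
Proof.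
move=> pv; rewrite -[LHS]mean_shift.
  by apply: eq_mean => k; congr v; lia.
by move=> xi; rewrite -(pv (xi - 1)); congr v; lia.
Qed.

(** A single term of a mean is at most 1 / eps times the mean: this is where
    the half power of eps between maximum and l^2 norms comes from. *)
Lemma term_le_mean v xi :
  periodic N v -> (forall k, 0 <= v k) -> eps R N * v xi <= mean N v.
Proof.
move=> pv v0; have [k hk ->] := periodic_repr xi N0 pv.
rewrite ler_wpM2l ?(ltW eps_gt0)//.
rewrite (bigD1_seq k)/= ?mem_index_iota ?iota_uniq//.
by rewrite lerDl sumr_ge0.
Qed.

Lemma norm_l2_ge0 v : 0 <= norm_l2 N v.
Proof. exact: sqrtr_ge0. Qed.

Lemma norm_l2_sqr v : norm_l2 N v ^+ 2 = mean N (fun k => v k ^+ 2).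
Proof.
rewrite sqr_sqrtr.
  by congr (_ * _); apply: eq_bigr => k _; rewrite real_normK ?num_real.
by rewrite mulr_ge0 ?(ltW eps_gt0)// sumr_ge0// => k _; rewrite exprn_ge0.
Qed.

(** Optimizing the parameter of Young's inequality; when one of the norms
    vanishes, the parameter is chosen to make the other term at most half
    of the left-hand side. *)
Lemma cauchy_schwarz v w :
  mean N (fun k => `|v k| * `|w k|) <= norm_l2 N v * norm_l2 N w.
Proof.
set p := norm_l2 N v; set q := norm_l2 N w.
have p0 : 0 <= p := norm_l2_ge0 v.
have q0 : 0 <= q := norm_l2_ge0 w.
have young (t : R) : 0 < t ->
    2 * mean N (fun k => `|v k| * `|w k|) <= t * p ^+ 2 + t^-1 * q ^+ 2.
  move=> t0; rewrite !norm_l2_sqr -!meanZ -meanD; apply: le_mean => k.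
  rewrite -(real_normK (num_real (v k))) -(real_normK (num_real (w k))).
  set x := `|v k|; set z := `|w k|.
  have -> : t * x ^+ 2 + t^-1 * z ^+ 2 = t^-1 * (t * x - z) ^+ 2 + 2 * (x * z).
    by field; rewrite gt_eqF.
  by rewrite lerDr mulr_ge0 ?sqr_ge0// invr_ge0 ltW.
have p1 (x : R) : 0 < x ^+ 2 + 1 by rewrite ltr_wpDl ?sqr_ge0//.
have [pe|pn] := eqVneq p 0; last have [qe|qn] := eqVneq q 0; last first.
- have pp : 0 < p by rewrite lt_def pn.
  have qp : 0 < q by rewrite lt_def qn.
  have := young (q / p) (divr_gt0 qp pp).
  have -> : q / p * p ^+ 2 + (q / p)^-1 * q ^+ 2 = 2 * (p * q).
    by field; rewrite ?pn ?qn.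
  by rewrite ler_pM2l.
- rewrite qe mulr0 leNgt; apply/negP => M0; have := young _ (divr_gt0 M0 (p1 p)).
  rewrite qe expr0n/= mulr0 addr0 mulrAC -mulrA.
  have : p ^+ 2 / (p ^+ 2 + 1) <= 1 by rewrite ler_pdivrMr// mul1r lerDl.
  by move=> /(ler_wpM2l (ltW M0)); rewrite mulr1 => h1 /le_trans/(_ h1); lra.
- rewrite pe mul0r leNgt; apply/negP => M0; have := young _ (divr_gt0 (p1 q) M0).
  rewrite pe invf_div expr0n/= mulr0 add0r mulrAC -mulrA.
  have : q ^+ 2 / (q ^+ 2 + 1) <= 1 by rewrite ler_pdivrMr// mul1r lerDl.
  by move=> /(ler_wpM2l (ltW M0)); rewrite mulr1 => h1 /le_trans/(_ h1); lra.
Qed.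

End Mean.

(** * A common form of the energies and its Taylor expansion *)

Lemma is_derive_subZ (R : realType) (g : R -> R) (q u dg : R) :
  is_derive u 1 g dg -> is_derive u 1 (fun x => g x - q * x) (dg - q).
Proof. by move=> gu; apply: is_derive_eq; rewrite /GRing.scale/= mulr1. Qed.

Section Energy.
Variables (R : realType) (phi : R -> R) (rstar : R).
Hypothesis hphi : potential phi rstar.
Variable N : nat.
Hypothesis N0 : (0 < N)%N.
Implicit Types a b r s w : int -> R.

(** Each interaction of second neighbours is charged with a weight: a k for the
    local (Cauchy-Born) bond 2 s_k, b k for the true bond s_k + s_(k+1).  The
    next two definitions are the first variation at s and the second variation
    at r, in the direction w. *)
Definition energy a b s : R := mean N (fun k =>
  phi (s k) + a k * phi (2 * s k) + b k * phi (s k + s (k + 1))).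

Definition denergy a b s w : R := mean N (fun k =>
  derive1n 1 phi (s k) * w k + a k * (derive1n 1 phi (2 * s k) * (2 * w k))
  + b k * (derive1n 1 phi (s k + s (k + 1)) * (w k + w (k + 1)))).

Definition d2energy a b r w : R := mean N (fun k =>
  derive1n 2 phi (r k) * w k ^+ 2
  + a k * (derive1n 2 phi (2 * r k) * (2 * w k) ^+ 2)
  + b k * (derive1n 2 phi (r k + r (k + 1)) * (w k + w (k + 1)) ^+ 2)).

Lemma PhiA_energy (y : int -> R) :
  PhiA phi N y = energy (fun=> 0) (fun=> 1) (D1 N y).
Proof.
by congr (_ * _); apply: eq_bigr => k _; rewrite mul0r addr0 mul1r. Qed.

(** Discrete summation by parts: reindexing moves each of the four weighted
    sums onto the bond it refers to, and the weights add up to alpha and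
    beta. *)
Lemma PhiQCE_energy (gamma y : int -> R) :
  periodic N gamma -> periodic N (D1 N y) ->
  PhiQCE phi N gamma y = energy (alpha gamma) (beta gamma) (D1 N y).
Proof.
move=> pg; set s := D1 N y => ps.
have pg' i xi : gamma (xi + N%:Z + i) = gamma (xi + i) by rewrite addrAC pg.
have ps' i xi : s (xi + N%:Z + i) = s (xi + i) by rewrite addrAC ps.
pose G k := gamma (k - 1) / 2 * phi (2 * s k).
pose P k := (1 - gamma (k + 1)) / 2 * phi (s k + s (k + 1)).
pose Q k := (1 - gamma (k - 1)) / 2 * phi (s k + s (k + 1)).
transitivity (mean N (fun k => (phi (s k) + gamma k / 2 * phi (2 * s k))
   + G (k + 1) + P (k - 1) + Q (k + 1))).
  congr (_ * _); apply: eq_bigr => k _; rewrite /G /P /Q !addrK ?subrK -/s.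
  rewrite (_ : k%:Z + 1 + 1 = k%:Z + 2); last by rewrite -addrA.
  ring.
rewrite !meanD (mean_shift N0 (v := G)) ?(mean_shift N0 (v := Q))
  ?(mean_shiftN N0 (v := P)) -?meanD.
- apply: eq_mean => k; rewrite /G /P /Q /alpha /beta; by field.
- by move=> xi; rewrite /P ps pg' ps'.
- by move=> xi; rewrite /Q ps pg' ps'.
- by move=> xi; rewrite /G ps pg'.
Qed.

Lemma potential_taylor (c d x h p : R) : 0 < c -> c <= p -> c <= x -> c <= x + h ->
  `|x - p| <= d -> `|x + h - p| <= d ->
  `|phi (x + h) - phi x - derive1n 1 phi x * h - derive1n 2 phi p * h ^+ 2 / 2|
    <= Csup phi 3 c * d * h ^+ 2 / 2.
Proof.
move=> c0 cp cx cxh xp xhp; set K := Csup phi 3 c.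
have btw z : Num.min x (x + h) <= z <= Num.max x (x + h) -> c <= z /\ `|z - p| <= d.
  rewrite ge_min le_max => /andP[h1 h2].
  move: xp xhp; rewrite !ler_norml => /andP[? ?] /andP[? ?].
  by case/orP: h1 => h1; case/orP: h2 => h2; split; try (apply/andP; split); lra.
have := @taylor_between R phi (derive1n 1 phi) x (x + h) (derive1n 2 phi p) (K * d).
rewrite (_ : x + h - x = h); last by lra.
apply => z hz.
  by apply: (potential_is_derive hphi (i := 0)) => //;
    apply: lt_le_trans c0 _; case: (btw _ hz).
pose g u := derive1n 1 phi u - derive1n 2 phi p * u.
have -> : derive1n 1 phi z - derive1n 1 phi x - derive1n 2 phi p * (z - x) = g z - g x.
  by rewrite /g; ring.
have sub u : Num.min x z <= u <= Num.max x z ->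
    Num.min x (x + h) <= u <= Num.max x (x + h).
  case/andP: hz => h1 h2 /andP[h3 h4]; apply/andP; split.
    by apply: le_trans h3; rewrite le_min h1 ge_min lexx.
  by apply: le_trans h4 _; rewrite ge_max h2 le_max lexx.
apply: (lipschitz_between (dg := fun u => derive1n 2 phi u - derive1n 2 phi p)).
  move=> u /sub/btw[cu _]; have u0 := lt_le_trans c0 cu.
  have := potential_is_derive hphi (i := 1) isT u0 => H.
  exact: is_derive_subZ.
move=> u /sub/btw[cu ud]; apply: (@le_trans _ _ (K * `|u - p|)); last first.
  by rewrite ler_wpM2l// (Csup_ge0 hphi).
have cmin v : Num.min p u <= v <= Num.max p u -> c <= v.
  by rewrite ge_min => /andP[/orP[] h1 _]; apply: le_trans h1.
apply: (lipschitz_between (dg := derive1n 3 phi)) => v /cmin cv.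
  exact: (potential_is_derive hphi (i := 2) isT (lt_le_trans c0 cv)).
exact: (Csup_ge hphi).
Qed.

(** The quadratic form is frozen at the centre r of the strain box rather than
    at s: the lower bound on the second variation is available at r only, and
    the concavity it relies on may fail at other points of the box.  The
    constant 17 = 1 + 8 + 8 adds the nearest-neighbour terms, the bonds 2 s_k
    (displacement 2 kappa, increment 2 w_k) and the bonds s_k + s_(k+1). *)
Lemma energy_taylor a b r s w (m kappa : R) :
  (forall k, 0 <= a k <= 1) -> (forall k, 0 <= b k <= 1) -> periodic N w ->
  0 < m -> kappa <= m / 2 -> (forall k, m <= r k) ->
  (forall k, `|s k - r k| <= kappa) -> (forall k, `|s k + w k - r k| <= kappa) ->
  `|energy a b (fun k => s k + w k) - energy a b s - denergy a b s w
     - d2energy a b r w / 2|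
    <= 17 / 2 * Csup phi 3 (m / 2) * kappa * mean N (fun k => w k ^+ 2).
Proof.
move=> ha hb pw m0 km hr hs hsw; set K := Csup _ _ _.
have c0 : 0 < m / 2 by rewrite divr_gt0.
have K0 : 0 <= K by apply: (Csup_ge0 hphi).
have k0 : 0 <= kappa := le_trans (normr_ge0 _) (hs 0).
pose W k := w k ^+ 2.
have pW : periodic N W by move=> xi; rewrite /W pw.
pose T x h p :=
  phi (x + h) - phi x - derive1n 1 phi x * h - derive1n 2 phi p * h ^+ 2 / 2.
have -> : energy a b (fun k => s k + w k) - energy a b s - denergy a b s w
     - d2energy a b r w / 2 =
  mean N (fun k => T (s k) (w k) (r k) + a k * T (2 * s k) (2 * w k) (2 * r k)
    + b k * T (s k + s (k + 1)) (w k + w (k + 1)) (r k + r (k + 1))).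
  rewrite (mulrC (d2energy _ _ _ _)) -meanZ -!meanB; apply: eq_mean => k.
  rewrite /T (_ : 2 * (s k + w k) = 2 * s k + 2 * w k); last by ring.
  rewrite (_ : s k + w k + (s (k + 1) + w (k + 1)) =
    s k + s (k + 1) + (w k + w (k + 1))); last by ring.
  move: (phi (_ + _)) (phi (2 * s k + _)) (phi (s k + s (k + 1) + _)) => p1 p2 p3.
  move: (phi (s k)) (phi (2 * s k)) (phi (s k + s (k + 1))) => p4 p5 p6.
  move: (derive1n 1 phi (s k)) (derive1n 1 phi (2 * s k)) => d1 d2.
  move: (derive1n 1 phi (s k + s (k + 1))) (derive1n 2 phi (r k)) => d3 e1.
  move: (derive1n 2 phi (2 * r k)) (derive1n 2 phi (r k + r (k + 1))) => e2 e3.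
  by field.
have -> : 17 / 2 * K * kappa * mean N (fun k => w k ^+ 2) =
  mean N (fun k => K * kappa * (9 / 2 * W k + 2 * W k + 2 * W (k + 1))).
  rewrite meanZ !meanD !meanZ (mean_shift N0 pW) -/W; by field.
apply: ler_norm_mean => // k.
have /ler_normlP[s1 s2] := hs k; have /ler_normlP[s3 s4] := hs (k + 1).
have /ler_normlP[t1 t2] := hsw k; have /ler_normlP[t3 t4] := hsw (k + 1).
have r1 := hr k; have r2 := hr (k + 1).
have T1 : `|T (s k) (w k) (r k)| <= K * kappa * w k ^+ 2 / 2.
  by apply: potential_taylor => //; lra.
have T2 : `|T (2 * s k) (2 * w k) (2 * r k)| <= K * (2 * kappa) * (2 * w k) ^+ 2 / 2.
  by apply: potential_taylor => //; rewrite ?ler_norml; try (apply/andP; split); lra.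
have T3 : `|T (s k + s (k + 1)) (w k + w (k + 1)) (r k + r (k + 1))|
    <= K * (2 * kappa) * (w k + w (k + 1)) ^+ 2 / 2.
  by apply: potential_taylor => //; rewrite ?ler_norml; try (apply/andP; split); lra.
have coef (x t B : R) : 0 <= x <= 1 -> `|t| <= B -> `|x * t| <= B.
  move=> /andP[x0 x1] tB; rewrite normrM (ger0_norm x0).
  by apply: le_trans tB; rewrite ler_piMl.
apply: le_trans (ler_normD _ _) _.
apply: le_trans (lerD (ler_normD _ _) (lexx _)) _.
apply: le_trans (lerD (lerD T1 (coef _ _ _ (ha k) T2)) (coef _ _ _ (hb k) T3)) _.
rewrite /W -subr_ge0.
have -> : K * kappa * (9 / 2 * w k ^+ 2 + 2 * w k ^+ 2 + 2 * w (k + 1) ^+ 2) -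
  (K * kappa * w k ^+ 2 / 2 + K * (2 * kappa) * (2 * w k) ^+ 2 / 2 +
   K * (2 * kappa) * (w k + w (k + 1)) ^+ 2 / 2) = K * kappa * (w k - w (k + 1)) ^+ 2.
  by field.
by rewrite (mulr_ge0 (mulr_ge0 K0 k0)) ?sqr_ge0//.
Qed.

Lemma denergy_stress a b s w : periodic N b -> periodic N s -> periodic N w ->
  denergy a b s w = mean N (fun k =>
    (derive1n 1 phi (s k) + 2 * a k * derive1n 1 phi (2 * s k)
     + b k * derive1n 1 phi (s k + s (k + 1))
     + b (k - 1) * derive1n 1 phi (s (k - 1) + s k)) * w k).
Proof.
move=> pb ps pw.
pose P k := b (k - 1) * derive1n 1 phi (s (k - 1) + s k) * w k.
have pP : periodic N P.
  by move=> xi; rewrite /P pw ps (addrAC xi) pb ps.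
transitivity (mean N (fun k => (derive1n 1 phi (s k) + 2 * a k * derive1n 1 phi (2 * s k)
     + b k * derive1n 1 phi (s k + s (k + 1))) * w k + P (k + 1))).
  by apply: eq_mean => k; rewrite /P !addrK; ring.
rewrite meanD (mean_shift N0 pP) -meanD.
by apply: eq_mean => k; rewrite /P; ring.
Qed.

(** By the parallelogram identity (u + v)^2 = 2 u^2 + 2 v^2 - (u - v)^2, and
    the terms dropped are nonnegative because phi'' <= 0 on all second-neighbour
    bonds. *)
Lemma d2energy_ge a b r w (m : R) :
  periodic N b -> periodic N r -> periodic N w -> (forall k, 0 <= b k) ->
  rstar / 2 <= m -> (forall k, m <= r k) ->
  mean N (fun k =>
    (derive1n 2 phi (r k) + 4 * a k * derive1n 2 phi (2 * r k)
     + 2 * b k * derive1n 2 phi (r k + r (k + 1))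
     + 2 * b (k - 1) * derive1n 2 phi (r (k - 1) + r k)) * w k ^+ 2)
  <= d2energy a b r w.
Proof.
move=> pb pr pw b0 hm hr.
pose P k := 2 * b (k - 1) * derive1n 2 phi (r (k - 1) + r k) * w k ^+ 2.
have pP : periodic N P.
  by move=> xi; rewrite /P pw pr (addrAC xi) pb pr.
have -> : mean N (fun k =>
    (derive1n 2 phi (r k) + 4 * a k * derive1n 2 phi (2 * r k)
     + 2 * b k * derive1n 2 phi (r k + r (k + 1))
     + 2 * b (k - 1) * derive1n 2 phi (r (k - 1) + r k)) * w k ^+ 2) =
  mean N (fun k => (derive1n 2 phi (r k) + 4 * a k * derive1n 2 phi (2 * r k)
     + 2 * b k * derive1n 2 phi (r k + r (k + 1))) * w k ^+ 2 + P (k + 1)).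
  rewrite meanD (mean_shift N0 pP) -meanD.
  apply: eq_mean => k; rewrite /P.
  move: (derive1n 2 phi (r k)) (derive1n 2 phi (2 * r k)) => e1 e2.
  move: (derive1n 2 phi (_ + _)) (derive1n 2 phi (_ + r k)) => e3 e4.
  by ring.
apply: le_mean => // k; rewrite /P !addrK -subr_ge0.
move: (hr k) (hr (k + 1)) => r1 r2.
set q := derive1n 2 phi (r k + r (k + 1)).
have q0 : q <= 0.
  by apply: (potential_concave hphi); lra.
move: q q0 => q q0; set d := (X in 0 <= X).
have -> : d = - q * (b k * (w k - w (k + 1)) ^+ 2) 
  by rewrite /d; move: (derive1n 2 phi _) (derive1n 2 phi _) => e1 e2; ring.
by rewrite mulr_ge0 ?oppr_ge0// mulr_ge0// sqr_ge0.
Qed.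

End Energy.

(** * Consistency and stability of the blended model *)

Lemma periodic_shift (R : realType) (N : nat) (v : int -> R) (i xi : int) :
  periodic N v -> v (xi + N%:Z + i) = v (xi + i).
Proof. by move=> pv; rewrite addrAC pv. Qed.

Lemma alpha_beta_range (R : realType) (N : nat) (gamma : int -> R) (xi : int) :
  blending N gamma -> 0 <= alpha gamma xi <= 1 /\ 0 <= beta gamma xi <= 1.
Proof.
move=> [_ hg]; have /andP[? ?] := hg xi; have /andP[? ?] := hg (xi - 1).
have /andP[? ?] := hg (xi + 1).
by rewrite /alpha /beta; split; apply/andP; split; lra.
Qed.

Lemma periodic_alpha (R : realType) (N : nat) (gamma : int -> R) :
  periodic N gamma -> periodic N (alpha gamma).
Proof. by move=> pg xi; rewrite /alpha pg periodic_shift. Qed.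

Lemma periodic_beta (R : realType) (N : nat) (gamma : int -> R) :
  periodic N gamma -> periodic N (beta gamma).
Proof. by move=> pg xi; rewrite /beta !periodic_shift. Qed.

Section Differences.
Variables (R : realType) (N : nat).
Hypothesis N0 : (0 < N)%N.
Local Notation e := (eps R N).
Implicit Types y u v : int -> R.

Let en0 : e != 0. Proof. by rewrite gt_eqF// eps_gt0. Qed.

Lemma D1_next y xi : D1 N y (xi + 1) - D1 N y xi = e * D2 N y xi.
Proof.
rewrite /D1 /D2 addrK; move: (y (xi + 1)) (y xi) (y (xi - 1)) => a b c.
by field.
Qed.

Lemma D2_next y xi : D2 N y xi - D2 N y (xi - 1) = e * D3 N y xi.
Proof.
rewrite /D2 /D3 ?subrK (_ : xi - 1 - 1 = xi - 2); last by rewrite -addrA.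
move: (y (xi + 1)) (y xi) (y (xi - 1)) (y (xi - 2)) => a b c d.
by field.
Qed.

Lemma periodic_D2 y : periodic N (D1 N y) -> periodic N (D2 N y).
Proof.
move=> py xi; apply: (mulfI en0); rewrite -!D1_next.
by rewrite periodic_shift// py.
Qed.

Lemma periodic_D3 y : periodic N (D1 N y) -> periodic N (D3 N y).
Proof.
move=> /periodic_D2 py xi; apply: (mulfI en0); rewrite -!D2_next.
by rewrite periodic_shift// py.
Qed.

Lemma norm_l2_shift v : periodic N v -> norm_l2 N (fun xi => v (xi - 1)) = norm_l2 N v.
Proof.
move=> pv; congr Num.sqrt.
apply: (@mean_shiftN R N N0 (fun xi => `|v xi| ^+ 2)) => xi.
by rewrite pv.
Qed.

End Differences.

Section Consistency.
Variables (R : realType) (phi : R -> R) (rstar : R).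
Hypothesis hphi : potential phi rstar.
Variable N : nat.
Hypothesis N0 : (0 < N)%N.
Variables (gamma y : int -> R) (m : R).
Hypothesis hgamma : blending N gamma.
Hypothesis py : periodic N (D1 N y).
Hypothesis m0 : 0 < m.
Hypothesis hm : forall xi, m <= D1 N y xi.

Local Notation e := (eps R N).
Local Notation r := (D1 N y).
Local Notation C i := (Csup phi i (2 * m)).

(** The three functions below, with the second difference of alpha, are the
    sources of modelling error named in the theorem. *)
Definition gap_grad xi := Delta (beta gamma) xi * D2 N y xi.
Definition gap_third xi := (1 - beta gamma (xi - 1)) * D3 N y xi.
Definition gap_square xi := (1 - beta gamma xi) * D2 N y xi ^+ 2.

(** For g = phi' this is the atomistic minus the blended stress; for g = phi''
    it is half the difference of the diagonal coefficients of the two second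
    variations. *)
Definition gap (g : R -> R) xi :=
  (1 - beta gamma xi) * g (r xi + r (xi + 1))
  + (1 - beta gamma (xi - 1)) * g (r (xi - 1) + r xi)
  - 2 * alpha gamma xi * g (2 * r xi).

Let pgamma : periodic N gamma := hgamma.1.

Lemma periodic_gap_alpha : periodic N (Delta2 (alpha gamma)).
Proof.
move=> xi; have pa := periodic_alpha pgamma.
by rewrite /Delta2 !(periodic_shift _ _ pa) pa.
Qed.

Lemma periodic_gap_grad : periodic N gap_grad.
Proof.
move=> xi; have pb := periodic_beta pgamma.
by rewrite /gap_grad /Delta (periodic_shift _ _ pb) pb periodic_D2.
Qed.

Lemma periodic_gap_third : periodic N gap_third.
Proof.
move=> xi; have pb := periodic_beta pgamma.
by rewrite /gap_third (periodic_shift _ _ pb) periodic_D3.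
Qed.

Lemma periodic_gap_square : periodic N gap_square.
Proof.
move=> xi; have pb := periodic_beta pgamma.
by rewrite /gap_square pb periodic_D2.
Qed.

(** The weights satisfy
    (1 - beta_k) + (1 - beta_(k-1)) - 2 alpha_k = (Delta^2 alpha)_k,
    so the gap vanishes to leading order where alpha is affine. *)
Lemma gap_split (g : R -> R) xi :
  gap g xi = Delta2 (alpha gamma) xi * g (2 * r xi)
    + (1 - beta gamma xi) * (g (r xi + r (xi + 1)) - g (2 * r xi))
    + (1 - beta gamma (xi - 1)) * (g (r (xi - 1) + r xi) - g (2 * r xi)).
Proof.
rewrite /gap; move: (g _) (g (_ + r xi)) (g _) => g1 g2 g3.
rewrite /Delta2 /alpha /beta !addrK ?subrK.
move: (gamma _) (gamma _) (gamma _) (gamma _) => c1 c2 c3 c4.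
by field.
Qed.

Lemma derive_remainder (i : nat) (p x : R) : (i < 3)%N -> 2 * m <= p -> 2 * m <= x ->
  `|derive1n i phi x - derive1n i phi p - derive1n i.+1 phi p * (x - p)|
    <= C i.+2 * (x - p) ^+ 2 / 2.
Proof.
move=> i3 hp hx; have c0 : 0 < 2 * m by rewrite mulr_gt0.
have cmin (u z : R) : 2 * m <= z -> Num.min p z <= u <= Num.max p z -> 2 * m <= u.
  by move=> hz; rewrite ge_min => /andP[/orP[] h1 _]; apply: le_trans h1.
have := @taylor_between R (derive1n i phi) (derive1n i.+1 phi) p x 0 (C i.+2).
rewrite !mul0r subr0; apply => z /(cmin _ _ hx) hz.
  by apply: (potential_is_derive hphi); [lia | exact: lt_le_trans hz].
rewrite mul0r subr0; apply: lipschitz_between => v /(cmin _ _ hz) hv.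
  by apply: (potential_is_derive hphi); [lia | exact: lt_le_trans hv].
by apply: (Csup_ge hphi).
Qed.

(** Expanding the two differences of [gap_split] around 2 r_k, the first-order
    terms carry (1 - beta_k) y''_k and -(1 - beta_(k-1)) y''_(k-1); a discrete
    product rule turns their sum into - Delta beta_k y''_k plus
    eps (1 - beta_(k-1)) y'''_k. *)
Lemma gap_bound (i : nat) xi : (i < 3)%N ->
  `|gap (derive1n i phi) xi| <=
    C i * `|Delta2 (alpha gamma) xi| + e * C i.+1 * `|gap_grad xi|
    + e ^+ 2 * (C i.+1 * `|gap_third xi|
        + C i.+2 * ((`|gap_square xi| + `|gap_square (xi - 1)|) / 2)).
Proof.
move=> i3; have c0 : 0 < 2 * m by rewrite mulr_gt0.
have e0 := ltW (eps_gt0 R N0).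
set g := derive1n i phi; set p := 2 * r xi.
have hp : 2 * m <= p by rewrite /p ler_pM2l.
have hx : 2 * m <= r xi + r (xi + 1) by have := hm xi; have := hm (xi + 1); lra.
have hz : 2 * m <= r (xi - 1) + r xi by have := hm xi; have := hm (xi - 1); lra.
have := derive_remainder i3 hp hx; have := derive_remainder i3 hp hz; rewrite -/g.
have n1 := D1_next N0 y xi; have n2 := D1_next N0 y (xi - 1); rewrite subrK in n2.
have n3 := D2_next N0 y xi.
have -> : r xi + r (xi + 1) - p = e * D2 N y xi by rewrite -n1 /p; ring.
have -> : r (xi - 1) + r xi - p = - (e * D2 N y (xi - 1)) by rewrite -n2 /p; ring.
rewrite gap_split -/p.
have gC : `|g p| <= C i by apply: (Csup_ge hphi) => //; lia.
have dgC : `|derive1n i.+1 phi p| <= C i.+1 by apply: (Csup_ge hphi) => //; lia.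
move: gC dgC.
have [_ /andP[_ b1]] := alpha_beta_range xi hgamma.
have [_ /andP[_ b2]] := alpha_beta_range (xi - 1) hgamma.
rewrite /gap_grad /gap_third /gap_square /Delta.
move: (g _) (g _) (g _) (derive1n i.+1 phi p) => gx gz gp dg gC dgC.
rewrite (ger0_norm (x := (1 - _) * D2 N y xi ^+ 2)); last first.
  by rewrite mulr_ge0 ?sqr_ge0// subr_ge0.
rewrite (ger0_norm (x := (1 - _) * D2 N y (xi - 1) ^+ 2)); last first.
  by rewrite mulr_ge0 ?sqr_ge0// subr_ge0.
move: b1 b2 n3; move: (beta gamma xi) (beta gamma (xi - 1)) (Delta2 _ _) => b b' d2a b1 b2.
move: (D2 N y xi) (D2 N y (xi - 1)) (D3 N y xi) => d d' t n3.
set e2 := gz - _ - _; set e1 := gx - _ - _ => hz' hx'.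
have -> : d2a * gp + (1 - b) * (gx - gp) + (1 - b') * (gz - gp) =
    d2a * gp - e * dg * ((b - b') * d) + e ^+ 2 * dg * ((1 - b') * t)
    + ((1 - b) * e1 + (1 - b') * e2).
  rewrite -mulrA -[e ^+ 2 * _ * _]mulrA expr2 -[e * e * _]mulrA.
  have -> : e * (dg * ((1 - b') * t)) = dg * ((1 - b') * (d - d')) by rewrite n3; ring.
  by rewrite /e1 /e2; ring.
have h1 : `|d2a * gp| <= C i * `|d2a| by rewrite normrM mulrC ler_wpM2r.
have h2 : `|e * dg * ((b - b') * d)| <= e * C i.+1 * `|(b - b') * d|.
  by rewrite normrM ler_wpM2r// normrM (ger0_norm e0) ler_wpM2l.
have h3 : `|e ^+ 2 * dg * ((1 - b') * t)| <= e ^+ 2 * (C i.+1 * `|(1 - b') * t|).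
  by rewrite mulrA normrM ler_wpM2r// normrM ger0_norm ?sqr_ge0// ler_wpM2l ?sqr_ge0.
have h4 : `|(1 - b) * e1| <= e ^+ 2 * (C i.+2 * ((1 - b) * d ^+ 2 / 2)).
  have -> : e ^+ 2 * (C i.+2 * ((1 - b) * d ^+ 2 / 2)) =
      (1 - b) * (C i.+2 * (e * d) ^+ 2 / 2) by ring.
  by rewrite normrM (ger0_norm (x := 1 - b)) ?subr_ge0// ler_wpM2l ?subr_ge0.
have h5 : `|(1 - b') * e2| <= e ^+ 2 * (C i.+2 * ((1 - b') * d' ^+ 2 / 2)).
  have -> : e ^+ 2 * (C i.+2 * ((1 - b') * d' ^+ 2 / 2)) =
      (1 - b') * (C i.+2 * (- (e * d')) ^+ 2 / 2) by ring.
  by rewrite normrM (ger0_norm (x := 1 - b')) ?subr_ge0// ler_wpM2l ?subr_ge0.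
apply: le_trans (ler_normD _ _) _.
apply: le_trans (lerD (ler_normD _ _) (ler_normD _ _)) _.
apply: le_trans (lerD (lerD (ler_normB _ _) (lexx _)) (lexx _)) _.
apply: le_trans (lerD (lerD (lerD h1 h2) h3) (lerD h4 h5)) _.
move: (C i) (C i.+1) (C i.+2) => c1 c2 c3.
by rewrite le_eqVlt; apply/orP; left; apply/eqP; field.
Qed.

Lemma gap_le_norms (i : nat) xi : (i < 3)%N ->
  `|gap (derive1n i phi) xi| <=
    C i * norm_inf N (Delta2 (alpha gamma)) + e * C i.+1 * norm_inf N gap_grad
    + e ^+ 2 * (C i.+1 * norm_inf N gap_third + C i.+2 * norm_inf N gap_square).
Proof.
move=> i3; apply: le_trans (gap_bound xi i3) _.
have c0 : 0 < 2 * m by rewrite mulr_gt0.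
have e0 := ltW (eps_gt0 R N0).
have C0 j : (j <= 4)%N -> 0 <= C j by move=> j4; apply: (Csup_ge0 hphi).
have le1 := le_norm_inf xi N0 periodic_gap_alpha.
have le2 := le_norm_inf xi N0 periodic_gap_grad.
have le3 := le_norm_inf xi N0 periodic_gap_third.
have le4 := le_norm_inf xi N0 periodic_gap_square.
have le5 := le_norm_inf (xi - 1) N0 periodic_gap_square.
have Ci : 0 <= C i by apply: C0; rewrite ltnW// ltnW.
have Ci1 : 0 <= C i.+1 by apply: C0; rewrite ltnW.
have Ci2 : 0 <= C i.+2 by apply: C0.
move: (C i) (C i.+1) (C i.+2) Ci Ci1 Ci2 => c1 c2 c3 p1 p2 p3.
move: le1 le2 le3 le4 le5.
move: (norm_inf _ _) (norm_inf _ _) (norm_inf _ _) (norm_inf _ _) => n1 n2 n3 n4.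
move: `|_| `|_| `|_| `|_| `|_| => q1 q2 q3 q4 q5 le1 le2 le3 le4 le5.
rewrite lerD ?lerD// ?ler_wpM2l// ?mulr_ge0// ?exprn_ge0//.
by rewrite lerD// ler_wpM2l//; lra.
Qed.

Lemma denergy_gap w : periodic N w ->
  denergy phi N (alpha gamma) (beta gamma) r w
    - denergy phi N (fun=> 0) (fun=> 1) r w
  = - mean N (fun xi => gap (derive1n 1 phi) xi * w xi).
Proof.
move=> pw; rewrite !denergy_stress//; last exact: periodic_beta.
rewrite -meanB -[RHS]mulN1r -meanZ; apply: eq_mean => xi; rewrite /gap.
move: (derive1n 1 phi (r xi)) (derive1n 1 phi (2 * r xi)) => e1 e2.
move: (derive1n 1 phi (_ + _)) (derive1n 1 phi (_ + r xi)) => e3 e4.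
by ring.
Qed.

(** Pairing each term of [gap_bound] with w and applying Cauchy-Schwarz
    termwise; the two halves of the quadratic term recombine because shifting
    a periodic function preserves its norm. *)
Lemma denergy_gap_le w : periodic N w ->
  `|denergy phi N (alpha gamma) (beta gamma) r w
    - denergy phi N (fun=> 0) (fun=> 1) r w|
  <= (C 1 * norm_l2 N (Delta2 (alpha gamma)) + e * C 2 * norm_l2 N gap_grad
      + e ^+ 2 * (C 2 * norm_l2 N gap_third + C 3 * norm_l2 N gap_square))
     * norm_l2 N w.
Proof.
move=> pw; rewrite denergy_gap// normrN.
have c0 : 0 < 2 * m by rewrite mulr_gt0.
have e0 := ltW (eps_gt0 R N0).
have C0 j : (j <= 4)%N -> 0 <= C j by move=> j4; apply: (Csup_ge0 hphi).
have C1 := C0 1%N isT; have C2 := C0 2%N isT; have C3 := C0 3%N isT.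
pose S (v : int -> R) : R := mean N (fun xi => `|v xi| * `|w xi|).
pose sq (xi : int) : R := gap_square (xi - 1).
pose B : R := C 1 * S (Delta2 (alpha gamma)) + e * C 2 * S gap_grad
  + e ^+ 2 * (C 2 * S gap_third + C 3 * ((S gap_square + S sq) / 2)).
apply: (@le_trans _ _ B); rewrite /B.
  have -> : C 1 * S (Delta2 (alpha gamma)) + e * C 2 * S gap_grad
      + e ^+ 2 * (C 2 * S gap_third + C 3 * ((S gap_square + S sq) / 2)) =
    mean N (fun xi => C 1 * (`|Delta2 (alpha gamma) xi| * `|w xi|)
      + e * C 2 * (`|gap_grad xi| * `|w xi|)
      + e ^+ 2 * (C 2 * (`|gap_third xi| * `|w xi|)
        + C 3 * (2^-1 * (`|gap_square xi| * `|w xi| + `|sq xi| * `|w xi|)))).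
    by rewrite !meanD !meanZ meanD !meanZ meanD (mulrC _ 2^-1).
  apply: ler_norm_mean => // xi; rewrite normrM.
  have := ler_wpM2r (normr_ge0 (w xi)) (@gap_bound 1 xi isT).
  move/le_trans; apply; rewrite /sq.
  move: (C 1) (C 2) (C 3) `|w xi| (Delta2 _ _) (gap_grad _) => c1 c2 c3 n1 n2 n3.
  move: (gap_third _) (gap_square _) (gap_square _) => n4 n5 n6.
  by rewrite le_eqVlt; apply/orP; left; apply/eqP; ring.
have CS v : S v <= norm_l2 N v * norm_l2 N w by apply: cauchy_schwarz.
have CSsq := CS sq; rewrite norm_l2_shift// in CSsq; last exact: periodic_gap_square.
have w0 := norm_l2_ge0 N w.
have := CS gap_square; have := CS gap_third; have := CS gap_grad.
have := CS (Delta2 (alpha gamma)); move: CSsq w0 e0 C1 C2 C3; rewrite {B CS}.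
move: (S _) (S _) (S _) (S _) (S _) => s1 s2 s3 s4 s5.
move: (norm_l2 N w) (norm_l2 _ _) (norm_l2 _ _) (norm_l2 _ _) (norm_l2 _ _) => n n1 n2 n3 n4.
move: (C 1) (C 2) (C 3) e => c1 c2 c3 h h5 n0 h0 c10 c20 c30 h1 h2 h3 h4.
rewrite !mulrDl lerD// ?lerD//; try by rewrite -!mulrA ?ler_wpM2l.
rewrite -mulrA ler_wpM2l ?exprn_ge0// mulrDl lerD// -mulrA ler_wpM2l//; lra.
Qed.

Lemma d2energy_gap_ge w : periodic N w -> rstar / 2 <= m ->
  (min_period N (Acoef phi N y)
   - (2 * C 2 * norm_inf N (Delta2 (alpha gamma)) + 2 * e * C 3 * norm_inf N gap_grad
      + 2 * e ^+ 2 * (C 3 * norm_inf N gap_third + C 4 * norm_inf N gap_square)))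
    * mean N (fun xi => w xi ^+ 2)
  <= d2energy phi N (alpha gamma) (beta gamma) r w.
Proof.
move=> pw hrs; rewrite -meanZ.
have b0 xi : 0 <= beta gamma xi by have [_ /andP[]] := alpha_beta_range xi hgamma.
apply: le_trans (d2energy_ge hphi N0 (alpha gamma) (periodic_beta pgamma) py pw b0 hrs hm).
apply: le_mean => // xi; rewrite ler_wpM2r ?sqr_ge0//.
have pA : periodic N (Acoef phi N y).
  by move=> k; rewrite /Acoef !(periodic_shift _ _ py) py.
have := min_period_le xi N0 pA.
have /ler_normlP[_] := @gap_le_norms 2 xi isT.
rewrite /gap /Acoef.
move: (derive1n 2 phi (r xi)) (derive1n 2 phi (2 * r xi)) => e1 e2.
move: (derive1n 2 phi (_ + _)) (derive1n 2 phi (_ + r xi)) => e3 e4.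
move: (norm_inf _ _) (norm_inf _ _) (norm_inf _ _) (norm_inf _ _) => n1 n2 n3 n4.
move: (C 2) (C 3) (C 4) (min_period _ _) (alpha gamma xi) => C2 C3 C4 A al.
move: (beta gamma xi) (beta gamma (xi - 1)) e => b b' ep.
lra.
Qed.

End Consistency.

(** * Deformations, displacements and their norms *)

Section Deformations.
Variables (R : realType) (N : nat).
Hypothesis N0 : (0 < N)%N.
Local Notation e := (eps R N).
Implicit Types y z u v : int -> R.

Lemma D1_addZ y v t xi : D1 N (fun k => y k + t * v k) xi = D1 N y xi + t * D1 N v xi.
Proof. by rewrite /D1; ring. Qed.

Lemma D1_sub y z xi : D1 N (z \- y) xi = D1 N z xi - D1 N y xi.
Proof. by rewrite /D1 /=; ring. Qed.

Lemma periodic_D1 v : periodic N v -> periodic N (D1 N v).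
Proof. by move=> pv xi; rewrite /D1 (periodic_shift _ _ pv) pv. Qed.

Lemma spaceY_D1 F y : spaceY N F y -> periodic N (D1 N y).
Proof.
case=> u [pu _] hy xi; rewrite /D1 !hy (periodic_shift _ _ pu) pu.
by congr (_ / _); rewrite !rmorphD/= !rmorphN/=; ring.
Qed.

Lemma spaceY_addZ F y v t : spaceY N F y -> spaceU N v ->
  spaceY N F (fun k => y k + t * v k).
Proof.
case=> u [pu su] hy [pv sv]; exists (fun k => u k + t * v k).
  split; first by move=> xi; rewrite pu pv.
  by rewrite big_split/= -mulr_sumr sv mulr0 addr0.
by move=> xi; rewrite hy addrA.
Qed.

Lemma spaceY_sub F y z : spaceY N F y -> spaceY N F z -> spaceU N (z \- y).
Proof.
case=> u [pu su] hy [v [pv sv] hz]; split.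
  by move=> xi /=; rewrite !hy !hz pu pv; ring.
under eq_bigr do rewrite /= hy hz opprD addrACA subrr add0r.
by rewrite sumrB su sv subrr.
Qed.

Lemma pairing_addZ (f : int -> R) y v t :
  pairing N f (fun k => y k + t * v k) = pairing N f y + t * pairing N f v.
Proof.
rewrite /pairing mulrCA -mulrDr; congr (_ * _); rewrite mulr_sumr -big_split/=.
by apply: eq_bigr => k _; ring.
Qed.

(** The bound grows with the index, which is harmless for compactness in the
    product topology.  A mean-zero function is within kappa of zero at 0, since
    its values over one period differ from the value at 0 by at most
    N eps kappa. *)
Lemma spaceU_bound v (kappa : R) : spaceU N v ->
  (forall xi, `|D1 N v xi| <= kappa) ->
  forall xi, `|v xi| <= kappa + `|xi|%:~R * (e * kappa).
Proof.
move=> [pv sv] hv; have e0 := eps_gt0 R N0.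
have k0 : 0 <= kappa := le_trans (normr_ge0 _) (hv 0).
have step xi : `|v xi - v (xi - 1)| <= e * kappa.
  have -> : v xi - v (xi - 1) = e * D1 N v xi by rewrite /D1 mulrC divfK// gt_eqF.
  by rewrite normrM (ger0_norm (ltW e0)) ler_wpM2l// ltW.
have far xi : `|v xi - v 0| <= `|xi|%:~R * (e * kappa).
  elim: xi => [|n ih|n ih]; first by rewrite subrr !normr0 mul0r.
  - rewrite (_ : v _ - v 0 = (v n.+1 - v (n.+1%:Z - 1)) + (v n - v 0)); last first.
      by rewrite (_ : n.+1%:Z - 1 = n%:Z); [ring | rewrite -addn1 PoszD addrK].
    apply: le_trans (ler_normD _ _) _.
    rewrite -addn1 PoszD (_ : `|n%:Z + 1%:Z| = 1 + `|n%:Z|); last by lia.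
    by rewrite rmorphD/= mulrDl mul1r lerD.
  - rewrite (_ : v _ - v 0 = - (v (- n%:Z) - v (- n%:Z - 1)) + (v (- n%:Z) - v 0)); last first.
      by rewrite (_ : - n%:Z - 1 = - n.+1%:Z); [ring | lia].
    apply: le_trans (ler_normD _ _) _; rewrite normrN.
    rewrite (_ : `|- n.+1%:Z| = 1 + `|- n%:Z|); last by lia.
    by rewrite rmorphD/= mulrDl mul1r lerD.
have v0 : `|v 0| <= kappa.
  have : N%:R * v 0 = - \sum_(1 <= k < N.+1) (v k%:Z - v 0).
    by rewrite sumrB sv sub0r opprK sumr_const_nat subn1 mulr_natl.
  move/(congr1 Num.norm); rewrite normrM normrN normr_nat => h.
  have : N%:R * `|v 0| <= N%:R * kappa.
    rewrite h; apply: le_trans (ler_norm_sum _ _ _) _.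
    apply: (@le_trans _ _ (\sum_(1 <= k < N.+1) kappa)); last first.
      by rewrite sumr_const_nat subn1 mulr_natl.
    apply: ler_sum_nat => k /andP[_ kN]; apply: le_trans (far _) _.
    rewrite mulrA ler_piMl// (_ : `|k%:Z|%:~R = k%:R :> R)//.
    have : k%:R * e <= N%:R * e by rewrite ler_wpM2r ?(ltW e0)// ler_nat.
    by rewrite [N%:R * e]mulrC epsN.
  by rewrite ler_pM2l// ltr0n.
move=> xi; rewrite -[v xi](subrK (v 0)) addrC.
by apply: le_trans (ler_normD _ _) _; rewrite lerD.
Qed.

Lemma spaceY_D1_inj F y z : spaceY N F y -> spaceY N F z ->
  D1 N z =1 D1 N y -> z = y.
Proof.
move=> hy hz hD; apply/funext => xi; apply/eqP; rewrite -subr_eq0 -normr_le0.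
have := spaceU_bound (kappa := 0) (spaceY_sub hy hz) _ xi.
rewrite !mulr0 addr0; apply => k.
by rewrite D1_sub hD subrr normr0.
Qed.

Lemma norm_l2E v : norm_l2 N v = Num.sqrt (mean N (fun k => v k ^+ 2)).
Proof. by rewrite -norm_l2_sqr// sqrtr_sqr ger0_norm// norm_l2_ge0. Qed.

Lemma norm_l2Z t v : norm_l2 N (fun k => t * v k) = `|t| * norm_l2 N v.
Proof.
rewrite !norm_l2E -sqrtr_sqr -sqrtrM ?sqr_ge0// -meanZ.
by congr Num.sqrt; apply: eq_mean => k; rewrite exprMn.
Qed.

Lemma norm_l2_eq0 v : periodic N v -> norm_l2 N v = 0 -> forall xi, v xi = 0.
Proof.
move=> pv n0 xi; apply/eqP; rewrite -sqrf_eq0 eq_le sqr_ge0 andbT.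
have pv2 : periodic N (fun k => v k ^+ 2) by move=> k; rewrite pv.
have := @term_le_mean R N N0 _ xi pv2 (fun k => sqr_ge0 (v k)).
by rewrite -norm_l2_sqr// n0 expr0n/= pmulr_rle0// eps_gt0.
Qed.

Lemma sup_le_norm_l2 v xi : periodic N v -> `|v xi| * Num.sqrt e <= norm_l2 N v.
Proof.
move=> pv; have e0 := ltW (eps_gt0 R N0).
have pv2 : periodic N (fun k => v k ^+ 2) by move=> k; rewrite pv.
rewrite -sqrtr_sqr -sqrtrM ?sqr_ge0// norm_l2E ler_wsqrtr// mulrC.
exact: (term_le_mean N0 xi pv2 (fun k => sqr_ge0 (v k))).
Qed.

End Deformations.

(** * First variations and minimizers on strain boxes *)

(** If L were nonzero, the linear term would dominate for small t of the sign
    opposite to that of L. *)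
Lemma quadratic_min0 (R : realType) (L M t0 : R) : 0 < t0 ->
  (forall t, `|t| <= t0 -> 0 <= t * L + t ^+ 2 * M) -> L = 0.
Proof.
move=> t00 h; apply/eqP; apply: contraT => L0.
have l0 : 0 < `|L| by rewrite normr_gt0.
have M0 : 0 < `|M| + 1 by rewrite ltr_wpDl.
(* small enough for |s L| <= t0 and for s M <= 1 / 2 *)
set s := Num.min (t0 / `|L|) (2^-1 / (`|M| + 1)).
have s0 : 0 < s by rewrite lt_min !divr_gt0.
have sL : s * `|L| <= t0 by rewrite -ler_pdivlMr// ge_min lexx.
have sM : s * M < 1.
  apply: (@le_lt_trans _ _ 2^-1); last by lra.
  have : s * (`|M| + 1) <= 2^-1 by rewrite -ler_pdivlMr// ge_min lexx orbT.
  apply: le_trans; rewrite ler_pM2l//; have := ler_norm M; lra.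
have := h (- (s * L)); rewrite normrN normrM gtr0_norm// => /(_ sL).
have -> : - (s * L) * L + (- (s * L)) ^+ 2 * M = - (s * L ^+ 2) * (1 - s * M) by ring.
by rewrite leNgt mulNr oppr_lt0 mulr_gt0// ?subr_gt0// mulr_gt0// exprn_even_gt0.
Qed.

Lemma sum_cvg (R : realType) (T : topologicalType) (N : nat) (x : T)
    (G : nat -> T -> R) :
  (forall k, G k @ x --> G k x) ->
  (fun t => \sum_(1 <= k < N.+1) G k t) @ x --> \sum_(1 <= k < N.+1) G k x.
Proof.
move=> h; exact: (@cvg_big R nat +%R 0 xpredT (@add_continuous R) T (nbhs x)
  (index_iota 1 N.+1) G (fun k => G k x) _ (fun k _ => h k)).
Qed.

Lemma mean_cvg (R : realType) (T : topologicalType) (N : nat) (x : T)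
    (G : int -> T -> R) :
  (forall k, G k @ x --> G k x) ->
  (fun t => mean N (G^~ t)) @ x --> mean N (G^~ x).
Proof. by move=> h; apply: cvgMl_tmp; apply: (sum_cvg (G := fun k => G k%:Z)). Qed.

Lemma diff_cvg (R : realType) (T : topologicalType) (x : T)
    (u : T -> int -> R) (i j : int) :
  (forall xi, u^~ xi @ x --> u x xi) ->
  (fun t => u t i - u t j) @ x --> u x i - u x j.
Proof. by move=> h; exact: cvgB (h _) (h _). Qed.

Lemma D1_cvg (R : realType) (T : topologicalType) (N : nat) (x : T)
    (u : T -> int -> R) :
  (forall xi, u^~ xi @ x --> u x xi) ->
  forall xi, (fun t => D1 N (u t) xi) @ x --> D1 N (u x) xi.
Proof.
move=> h xi; rewrite /D1; have H := diff_cvg (i := xi) (j := xi - 1) h.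
exact: cvgMr_tmp H.
Qed.

Section Minimizers.
Variables (R : realType) (phi : R -> R) (rstar : R).
Hypothesis hphi : potential phi rstar.
Variable N : nat.
Hypothesis N0 : (0 < N)%N.
Variables (F : R) (f a b : int -> R).
Hypothesis ha : forall k, 0 <= a k <= 1.
Hypothesis hb : forall k, 0 <= b k <= 1.
Implicit Types y z v : int -> R.

Definition total z := energy phi N a b (D1 N z) - pairing N f z.

(** Along the segment y + t v the energy changes by t times its first variation
    plus a term of order t^2, by [energy_taylor] around y; minimality leaves no
    room for the linear term. *)
Lemma first_variation (E : (int -> R) -> R) y v :
  (forall z, deformation N F z -> E z = total z) ->
  local_minimizer N F E y -> spaceU N v ->
  denergy phi N a b (D1 N y) (D1 N v) = pairing N f v.
Proof.
move=> hE [[yY y0] [rho rho0 hmin]] hv.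
have py := spaceY_D1 yY; have pv := periodic_D1 hv.1.
set m := min_period N (D1 N y); have m0 : 0 < m by exact: min_period_gt0.
have hm xi : m <= D1 N y xi by exact: min_period_le.
set W := norm_inf N (D1 N v).
have hW xi : `|D1 N v xi| <= W by exact: le_norm_inf.
have W1 : 0 < W + 1 by rewrite ltr_wpDl// (le_trans _ (hW 0)).
set n := norm_l2 N (D1 N v); have n1 : 0 < n + 1 by rewrite ltr_wpDl// norm_l2_ge0.
pose t0 := Num.min (m / 2 / (W + 1)) (rho / 2 / (n + 1)).
have t00 : 0 < t0 by rewrite lt_min !divr_gt0.
apply/eqP; rewrite -subr_eq0; apply/eqP.
pose H := d2energy phi N a b (D1 N y) (D1 N v).
pose S := 17 / 2 * Csup phi 3 (m / 2) * (m / 2) * mean N (fun k => D1 N v k ^+ 2).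
(* t0 keeps y + t v within the strain box of radius m / 2 and within rho. *)
apply: (@quadratic_min0 _ _ (H / 2 + S) t0) => // t ht.
pose z k := y k + t * v k.
have zY : spaceY N F z by exact: spaceY_addZ.
have Dz xi : D1 N z xi = D1 N y xi + t * D1 N v xi by exact: D1_addZ.
have tm xi : `|t * D1 N v xi| <= m / 2.
  rewrite normrM; apply: (@le_trans _ _ (t0 * (W + 1))).
    by apply: ler_pM => //; have := hW xi; lra.
  by rewrite -ler_pdivlMr// ge_min lexx.
have zdef : deformation N F z.
  split=> // xi; rewrite Dz; have /ler_normlP[? ?] := tm xi; have := hm xi; lra.
have ydef : deformation N F y by [].
have zn : norm_U12 N (z \- y) < rho.
  rewrite /norm_U12 (_ : D1 N (z \- y) = fun xi => t * D1 N v xi); last first.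
    by apply/funext => xi; rewrite D1_sub Dz addrC addKr.
  rewrite norm_l2Z// -/n; apply: (@le_lt_trans _ _ (t0 * (n + 1))).
    by apply: ler_pM => //; [exact: norm_l2_ge0 | lra].
  apply: (@le_lt_trans _ _ (rho / 2)); last by lra.
  by rewrite -ler_pdivlMr// ge_min lexx orbT.
have := hmin z zdef zn; rewrite !hE// /total pairing_addZ -subr_ge0.
pose w xi := t * D1 N v xi.
have -> : D1 N z = fun xi => D1 N y xi + w xi by apply/funext => xi; rewrite Dz.
have pw : periodic N w by move=> xi; rewrite /w pv.
have dw : denergy phi N a b (D1 N y) w = t * denergy phi N a b (D1 N y) (D1 N v).
  rewrite -meanZ; apply: eq_mean => k; rewrite /w.
  move: (derive1n 1 phi (D1 N y k)) (derive1n 1 phi (2 * _)) => d1 d2.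
  by move: (derive1n 1 phi _) => d3; ring.
have d2w : d2energy phi N a b (D1 N y) w = t ^+ 2 * H.
  rewrite -meanZ; apply: eq_mean => k; rewrite /w.
  move: (derive1n 2 phi (D1 N y k)) (derive1n 2 phi (2 * _)) => d1 d2.
  by move: (derive1n 2 phi _) => d3; ring.
have sw : mean N (fun k => w k ^+ 2) = t ^+ 2 * mean N (fun k => D1 N v k ^+ 2).
  by rewrite -meanZ; apply: eq_mean => k; rewrite /w exprMn.
have := @energy_taylor _ _ _ hphi N N0 a b (D1 N y) (D1 N y) w m (m / 2)
  ha hb pw m0 (lexx _) hm.
have m2 : 0 <= m / 2 by rewrite divr_ge0// ltW.
rewrite dw d2w sw => /(_ _ _)/ler_normlP[].
- by move=> k; rewrite subrr normr0.
- by move=> k; rewrite addrC addKr; exact: tm.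
rewrite /S {dw d2w sw}; move: (energy _ _ _ _ _) (energy _ _ _ _ _)
  (denergy _ _ _ _ _ _) => E1 E2 dE.
move: (Csup _ _ _) (mean _ _) (pairing _ _ _) (pairing _ _ _) H => c mm p1 p2 h.
move: (m / 2) => m'.
move=> _; move: (t ^+ 2) => t2; lra.
Qed.

Lemma energy_cvg (T : topologicalType) (x : T) (r : T -> int -> R) :
  (forall xi, r^~ xi @ x --> r x xi) -> (forall xi, 0 < r x xi) ->
  (fun t => energy phi N a b (r t)) @ x --> energy phi N a b (r x).
Proof.
move=> h pos.
have phi_cvg (g : T -> R) : 0 < g x -> g @ x --> g x ->
    (fun t => phi (g t)) @ x --> phi (g x).
  move=> g0 hg; apply: (cvg_comp _ _ hg).
  exact: (potential_continuous hphi (i := 0) isT g0).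
apply: (mean_cvg (G := fun k t =>
  phi (r t k) + a k * phi (2 * r t k) + b k * phi (r t k + r t (k + 1)))) => k.
have h2 : (fun t => 2 * r t k) @ x --> 2 * r x k by exact: cvgMl_tmp (h k).
have h3 : (fun t => r t k + r t (k + 1)) @ x --> r x k + r x (k + 1).
  exact: cvgD (h k) (h (k + 1)).
have p2 := phi_cvg _ (mulr_gt0 (ltr0n R 2) (pos k)) h2.
have p3 := phi_cvg _ (addr_gt0 (pos k) (pos (k + 1))) h3.
have p1 := phi_cvg _ (pos k) (h k).
have q2 : (fun t => a k * phi (2 * r t k)) @ x --> a k * phi (2 * r x k).
  exact: cvgMl_tmp p2.
have q3 : (fun t => b k * phi (r t k + r t (k + 1))) @ x -->
    b k * phi (r x k + r x (k + 1)) by exact: cvgMl_tmp p3.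
have q1 : (fun t => phi (r t k) + a k * phi (2 * r t k)) @ x -->
    phi (r x k) + a k * phi (2 * r x k) by exact: cvgD p1 q2.
exact: cvgD q1 q3.
Qed.

Lemma total_cvg (T : topologicalType) (x : T) (u : T -> int -> R) :
  (forall xi, u^~ xi @ x --> u x xi) -> (forall xi, 0 < D1 N (u x) xi) ->
  (fun t => total (u t)) @ x --> total (u x).
Proof.
move=> h pos; have hE := energy_cvg (D1_cvg (N := N) h) pos.
have hp : (fun t => pairing N f (u t)) @ x --> pairing N f (u x).
  apply: (mean_cvg (G := fun k t => f k * u t k)) => k; exact: cvgMl_tmp (h k).
exact: cvgB hE hp.
Qed.

Local Notation X := (prod_topology (fun _ : int => R^o)).

(** Elements of the product space of functions on the integers, seen as plain
    functions with codomain R, so that the continuity lemmas apply to them. *)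
Definition values (x : X) : int -> R := x.

Lemma values_cvg (x : X) (xi : int) : values^~ xi @ x --> values x xi.
Proof. exact: (@proj_continuous int (fun _ => R^o)). Qed.

(** Displacements in the box are bounded at each index, hence form a closed
    subset of a product of segments, compact by Tychonoff's theorem. *)
Lemma box_minimizer y (kappa : R) :
  spaceY N F y -> 0 <= kappa -> (forall xi, kappa < D1 N y xi) ->
  exists2 z, spaceY N F z /\ (forall xi, `|D1 N z xi - D1 N y xi| <= kappa) &
    forall z', spaceY N F z' -> (forall xi, `|D1 N z' xi - D1 N y xi| <= kappa) ->
      total z <= total z'.
Proof.
move=> yY k0 hk.
pose K : set X := [set v | spaceU N v /\ forall xi, `|D1 N v xi| <= kappa].
have Dadd (v : int -> R) xi : D1 N (fun k => y k + v k) xi = D1 N y xi + D1 N v xi.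
  by rewrite /D1; ring.
have Kpos (v : X) : K v -> forall xi, 0 < D1 N (fun k => y k + v k) xi.
  move=> [_ hv] xi; rewrite Dadd; have := hk xi; have /ler_normlP[] := hv xi; lra.
have cK : compact K.
  pose B (xi : int) : set R := `[- (kappa + `|xi|%:~R * (eps R N * kappa)),
                                  kappa + `|xi|%:~R * (eps R N * kappa)]%classic.
  have cB : compact [set v : X | forall xi, B xi (v xi)].
    by apply: (@tychonoff int (fun _ => R^o) B) => xi; exact: segment_compact.
  apply: subclosed_compact cB _.
  - rewrite (_ : K = (\bigcap_(xi : int) [set v : X | v (xi + N%:Z) - v xi = 0])
        `&` [set v : X | \sum_(1 <= k < N.+1) v k%:Z = 0]
        `&` (\bigcap_(xi : int) [set v : X | `|D1 N v xi| <= kappa])); last first.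
      apply/seteqP; split => [v [[pv sv] hv]|v [[pv sv] hv]].
        by split=> [|xi _]; [split=> // xi _ /=; rewrite pv subrr | exact: hv].
      split; [split=> // xi | by move=> xi; exact: hv].
      by apply/eqP; rewrite -subr_eq0; apply/eqP; exact: pv.
    apply: closedI; first apply: closedI.
    + apply: closed_bigI => xi _.
      apply: (@preimage_closed X R (fun v => values v (xi + N%:Z) - values v xi) [set 0]).
        by move=> x _; exact: (diff_cvg (@values_cvg x)).
      exact: closed_eq.
    + apply: (@preimage_closed X R (fun v => \sum_(1 <= k < N.+1) values v k%:Z) [set 0]).
        move=> x _; exact: (@sum_cvg R X N x (fun k v => values v k%:Z)
          (fun k => @values_cvg x k%:Z)).
      exact: closed_eq.
    + apply: closed_bigI => xi _.
      apply: (@preimage_closed X R (fun v => `|D1 N (values v) xi|) [set r | r <= kappa]).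
        move=> x _; have H := @D1_cvg R X N x values (@values_cvg x) xi.
        exact: cvg_norm H.
      exact: closed_le.
  - move=> v [hU hv] xi; rewrite /B /= in_itv/= -ler_norml.
    exact: spaceU_bound.
have K_0 : K !=set0.
  exists (fun=> 0); split=> [|xi]; last by rewrite /D1 subrr mul0r normr0.
  by split=> //; rewrite big1.
have cE : {within K, continuous (fun v : X => total (fun k => y k + v k))}.
  apply: continuous_in_subspaceT => v; rewrite inE => Kv.
  apply: (@total_cvg X v (fun t k => y k + values t k)); last exact: Kpos.
  by move=> xi; exact: cvgD (cvg_cst _) (@values_cvg v xi).
have [v vK vmin] := compact_EVT_min K_0 cK cE.
move: vK; rewrite inE => -[vU hv].
have add1 (u : int -> R) : (fun k => y k + u k) = (fun k => y k + 1 * u k).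
  by apply/funext => k; rewrite mul1r.
exists (fun k => y k + v k).
  split; first by rewrite add1; exact: spaceY_addZ.
  by move=> xi; rewrite Dadd addrC addKr.
move=> z zY hz; pose u : X := z \- y.
have -> : z = (fun k => y k + u k) by apply/funext => k; rewrite /u /= addrC subrK.
apply: vmin; rewrite inE; split; first exact: spaceY_sub yY zY.
by move=> xi; rewrite D1_sub.
Qed.

End Minimizers.

(** * The blended minimizer *)

Section NearAtomisticMinimizer.
Variables (R : realType) (phi : R -> R) (rstar : R).
Hypothesis hphi : potential phi rstar.
Variable N : nat.
Hypothesis N0 : (0 < N)%N.
Variables (F : R) (f y gamma : int -> R).
Hypothesis hgamma : blending N gamma.
Hypothesis ymin : local_minimizer N F (PhiA_total phi N f) y.

Local Notation e := (eps R N).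
Local Notation A := (min_period N (Acoef phi N y)).
Local Notation m := (min_period N (D1 N y)).
Local Notation C i := (Csup phi i (2 * m)).
Local Notation Tot := (total phi N f (alpha gamma) (beta gamma)).

Hypothesis A0 : 0 < A.
Hypothesis hrs : rstar / 2 <= m.

Variable kappa : R.
Hypothesis k0 : 0 < kappa.
Hypothesis km : kappa <= m / 2.
Hypothesis kK : 68 * Csup phi 3 (m / 2) * kappa <= A.

Definition stability_gap : R :=
  2 * C 2 * norm_inf N (Delta2 (alpha gamma))
  + 2 * e * C 3 * norm_inf N (gap_grad N gamma y)
  + 2 * e ^+ 2 * (C 3 * norm_inf N (gap_third N gamma y)
      + C 4 * norm_inf N (gap_square N gamma y)).

Definition residual : R :=
  C 1 * norm_l2 N (Delta2 (alpha gamma)) + e * C 2 * norm_l2 N (gap_grad N gamma y)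
  + e ^+ 2 * (C 2 * norm_l2 N (gap_third N gamma y)
      + C 3 * norm_l2 N (gap_square N gamma y)).

Hypothesis hstab : stability_gap <= A / 4.
Hypothesis hres : residual <= Num.sqrt e * (A * kappa / 8).

Let yY : spaceY N F y.
Proof. exact: (ymin.1.1). Qed.
Let py : periodic N (D1 N y).
Proof. exact: (spaceY_D1 yY). Qed.
Let hm xi : m <= D1 N y xi.
Proof. exact: (min_period_le xi N0 py). Qed.
Let m0 : 0 < m.
Proof. exact: (min_period_gt0 N ymin.1.2). Qed.
Let ha k : 0 <= alpha gamma k <= 1.
Proof. exact: ((alpha_beta_range k hgamma).1). Qed.
Let hb k : 0 <= beta gamma k <= 1.
Proof. exact: ((alpha_beta_range k hgamma).2). Qed.

Let in_box z := spaceY N F z /\ forall xi, `|D1 N z xi - D1 N y xi| <= kappa.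

Lemma box_deformation z : in_box z -> deformation N F z.
Proof.
move=> [zY hz]; split=> // xi.
have /ler_normlP[] := hz xi; have := hm xi; have := m0; move: km; lra.
Qed.

Lemma PhiQCE_totalE z : deformation N F z -> PhiQCE_total phi N gamma f z = Tot z.
Proof.
move=> [zY _]; rewrite /PhiQCE_total PhiQCE_energy//.
- exact: hgamma.1.
- exact: spaceY_D1 zY.
Qed.

(** Strong convexity on the box: half of the second variation at y contributes
    3 A / 8, and the choice of kappa limits the error of freezing it at y to
    (17 / 2) Csup kappa <= A / 8. *)
Lemma total_growth u z : in_box u -> in_box z ->
  Tot u + (denergy phi N (alpha gamma) (beta gamma) (D1 N u) (D1 N (z \- u))
           - pairing N f (z \- u)) + A / 4 * norm_U12 N (z \- u) ^+ 2 <= Tot z.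
Proof.
move=> [uY hu] [zY hz]; set w := D1 N (z \- u).
have pw : periodic N w by apply: periodic_D1; exact: (spaceY_sub uY zY).1.
have Dz : D1 N z = fun k => D1 N u k + w k.
  by apply/funext => k; rewrite /w D1_sub addrC subrK.
have hw k : `|D1 N u k + w k - D1 N y k| <= kappa.
  by have := hz k; rewrite Dz.
have := @energy_taylor _ _ _ hphi N N0 _ _ _ _ w m kappa ha hb pw m0 km hm hu hw.
have := d2energy_gap_ge hphi N0 hgamma py m0 hm pw hrs.
rewrite -/stability_gap /total Dz /norm_U12 norm_l2_sqr// -/w.
have -> : pairing N f z = pairing N f u + pairing N f (z \- u).
  rewrite -[pairing N f (z \- u)]mul1r -pairing_addZ; congr (eps R N * _).
  by apply: eq_bigr => k _; rewrite /= mul1r addrC subrK.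
have := @mean_ge0 R N N0 _ (fun k => sqr_ge0 (w k)).
move: (mean N _) hstab kK => n2 h1 h2 n20.
move: (d2energy _ _ _ _ _ _) (denergy _ _ _ _ _ _) (energy _ _ _ _ _) (energy _ _ _ _ _).
move=> H dE E2 E1 hH /ler_normlP[hE _].
have p1 : stability_gap * n2 <= A / 4 * n2 by rewrite ler_wpM2r.
have p2 : 68 * Csup phi 3 (m / 2) * kappa * n2 <= A * n2 by rewrite ler_wpM2r.
move: hH hE p1 p2; move: (pairing _ _ _) (pairing _ _ _) => q1 q2.
move: (Csup phi 3 _) => K'.
lra.
Qed.

Lemma residual_ge0 : 0 <= residual.
Proof.
have c0 : 0 < 2 * m by rewrite mulr_gt0.
have e0 := ltW (eps_gt0 R N0).
by rewrite /residual !(addr_ge0, mulr_ge0, exprn_ge0, norm_l2_ge0, Csup_ge0 hphi).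
Qed.

Lemma norm_U12C (u v : int -> R) : norm_U12 N (u \- v) = norm_U12 N (v \- u).
Proof.
rewrite /norm_U12 (_ : D1 N (u \- v) = fun k => -1 * D1 N (v \- u) k).
  by rewrite norm_l2Z// normrN1 mul1r.
by apply/funext => k; rewrite !D1_sub; ring.
Qed.

Lemma strain_near_of_norm (u v : int -> R) xi : spaceY N F u -> spaceY N F v ->
  norm_U12 N (v \- u) <= Num.sqrt e * (kappa / 2) ->
  `|D1 N v xi - D1 N u xi| <= kappa / 2.
Proof.
move=> uY vY h; have q0 : 0 < Num.sqrt e by rewrite sqrtr_gt0 eps_gt0.
have pw : periodic N (D1 N (v \- u)) by apply: periodic_D1; exact: (spaceY_sub uY vY).1.
have := le_trans (sup_le_norm_l2 N0 xi pw) h.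
by rewrite mulrC ler_pM2l// D1_sub.
Qed.

Lemma qce_minimizer :
  exists2 yg : int -> R,
    locally_unique_minimizer N F (PhiQCE_total phi N gamma f) yg &
    norm_U12 N (y \- yg) <= 4 / A * residual.
Proof.
have q0 : 0 < Num.sqrt e by rewrite sqrtr_gt0 eps_gt0.
have kD xi : kappa < D1 N y xi.
  have := hm xi; have := m0; have := k0; have := km; lra.
have [yg nyg ygmin] := box_minimizer hphi N0 f (alpha gamma) (beta gamma) yY (ltW k0) kD.
have ny : in_box y by split=> // xi; rewrite subrr normr0 ltW.
have ygY := nyg.1; have vU := spaceY_sub yY ygY.
set n := norm_U12 N (yg \- y).
have n0 : 0 <= n by exact: norm_l2_ge0.
have n_le : n <= 4 / A * residual.
  have FV : denergy phi N (fun=> 0) (fun=> 1) (D1 N y) (D1 N (yg \- y))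
      = pairing N f (yg \- y).
    apply: (first_variation hphi N0 _ _ _ ymin vU) => [k|k|z _].
    - by rewrite lexx ler01.
    - by rewrite ler01 lexx.
    - by rewrite /PhiA_total PhiA_energy.
  have pw : periodic N (D1 N (yg \- y)) by apply: periodic_D1; exact: vU.1.
  have := denergy_gap_le hphi N0 hgamma py m0 hm pw; rewrite FV => /ler_normlP[h1 _].
  have h2 := total_growth ny nyg.
  have h3 := ygmin y yY ny.2.
  have : A / 4 * n ^+ 2 <= residual * n.
    move: h1 h2 h3; rewrite -/n -/residual.
    move: (denergy _ _ _ _ _ _) (total _ _ _ _ _ _) (total _ _ _ _ _ _) => dE T1 T2.
    move: (pairing _ _ _) (residual * n) (A / 4 * n ^+ 2) => p r a; lra.
  have [->|nn0] := eqVneq n 0.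
    by rewrite mulr_ge0 ?residual_ge0// divr_ge0// ltW.
  have np : 0 < n by rewrite lt_def nn0.
  rewrite expr2 mulrA ler_pM2r// => h.
  rewrite -(ler_pM2l (_ : 0 < A / 4)) ?divr_gt0// mulrA.
  by rewrite (_ : A / 4 * (4 / A) = 1) ?mul1r//; field; rewrite gt_eqF.
have n_small : n <= Num.sqrt e * (kappa / 2).
  apply: le_trans n_le _; apply: le_trans (ler_wpM2l _ hres) _.
    by rewrite divr_ge0// ltW.
  by rewrite le_eqVlt; apply/orP; left; apply/eqP; field; rewrite gt_eqF.
pose rho := Num.sqrt e * (kappa / 2).
have rho0 : 0 < rho by rewrite mulr_gt0// divr_gt0// k0.
have near_yg z : spaceY N F z -> norm_U12 N (z \- yg) < rho -> in_box z.
  move=> zY /ltW hz; split=> // xi.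
  have := strain_near_of_norm xi ygY zY hz; have := strain_near_of_norm xi yY ygY n_small.
  move=> /ler_normlP[? ?] /ler_normlP[? ?]; rewrite ler_norml; apply/andP; split; lra.
have ygdef := box_deformation nyg.
exists yg; last by rewrite norm_U12C.
split.
  split=> //; exists rho => // z zdef hz.
  rewrite !PhiQCE_totalE//; apply: ygmin; first exact: zdef.1.
  exact: (near_yg z zdef.1 hz).2.
exists rho => // z zmin hz.
have zdef := zmin.1; have nz := near_yg z zdef.1 hz.
have FV : denergy phi N (alpha gamma) (beta gamma) (D1 N z) (D1 N (yg \- z))
    = pairing N f (yg \- z).
  apply: (first_variation hphi N0 ha hb PhiQCE_totalE zmin).
  exact: spaceY_sub zdef.1 ygY.
have := total_growth nz nyg; rewrite FV subrr addr0.
have := ygmin z zdef.1 nz.2 => h1 h2.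
have : A / 4 * norm_U12 N (yg \- z) ^+ 2 <= 0 by lra.
rewrite pmulr_rle0 ?divr_gt0// => h3.
have {h3} nz0 : norm_U12 N (yg \- z) = 0.
  by apply/eqP; rewrite -sqrf_eq0 eq_le h3 sqr_ge0.
apply: (spaceY_D1_inj N0 ygY zdef.1) => xi; apply/esym/eqP; rewrite -subr_eq0 -D1_sub.
apply/eqP; apply: (norm_l2_eq0 N0 _ nz0).
by apply: periodic_D1; exact: (spaceY_sub zdef.1 ygY).1.
Qed.

End NearAtomisticMinimizer.

Theorem theorem5p1 (R : realType) (phi : R -> R) (rstar : R)
    (hphi : potential phi rstar) :
  exists (delta1 : R -> R)
         (delta2 : R -> R -> R -> R -> R -> (int -> R) -> R),
  forall (N : nat) (F : R) (f y gamma : int -> R),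
    (0 < N)%N -> 0 < F -> spaceU N f ->
    local_minimizer N F (PhiA_total phi N f) y ->
    blending N gamma ->
    let e : R := eps R N in
    let A : R := min_period N (Acoef phi N y) in
    let m : R := min_period N (D1 N y) in
    let C (i : nat) : R := Csup phi i (2 * m) in
    let a : int -> R := alpha gamma in
    let b : int -> R := beta gamma in
    let d2a : int -> R := Delta2 a in
    let dby2 : int -> R := fun xi => Delta b xi * D2 N y xi in
    let by3 : int -> R := fun xi => (1 - b (xi - 1)) * D3 N y xi in
    let by22 : int -> R := fun xi => (1 - b xi) * D2 N y xi ^+ 2 in
    let d1 : R := delta1 A in
    let d2 : R := delta2 m A (C 1%N) (C 2%N) (C 3%N) gamma in
    0 < A -> rstar / 2 <= m ->
    [/\ 0 < d1, 0 < d2 &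
      2 * C 2%N * norm_inf N d2a + 2 * e * C 3%N * norm_inf N dby2
        + 2 * e ^+ 2 * (C 3%N * norm_inf N by3 + C 4%N * norm_inf N by22)
        <= d1 ->
      e `^ (- 2^-1) * C 1%N * norm_l2 N d2a
        + e `^ (2^-1) * C 2%N * norm_l2 N dby2
        + e `^ (3 / 2) * (C 2%N * norm_l2 N by3 + C 3%N * norm_l2 N by22)
        <= d2 ->
      exists2 yg : int -> R,
        locally_unique_minimizer N F (PhiQCE_total phi N gamma f) yg &
        norm_U12 N (y \- yg) <=
          4 / A * (C 1%N * norm_l2 N d2a + e * C 2%N * norm_l2 N dby2
                   + e ^+ 2 * (C 2%N * norm_l2 N by3 + C 3%N * norm_l2 N by22))].
Proof.
(* The first bound keeps the strains of the box above m / 2, where the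
   Lipschitz constant Csup phi 3 (m / 2) of phi'' is available; the second is
   what strong convexity requires. *)
pose kap (m A : R) := Num.min (m / 2) (A / (68 * (Csup phi 3 (m / 2) + 1))).
exists (fun A => A / 4), (fun m A _ _ _ _ => A * kap m A / 8).
move=> N F f y gamma N0 _ _ ymin hg e A m C a b d2a dby2 by3 by22 d1 d2 A0 hrs.
have m0 : 0 < m by exact: min_period_gt0 ymin.1.2.
have K0 : 0 <= Csup phi 3 (m / 2) by apply: (Csup_ge0 hphi); rewrite ?divr_gt0.
have k0 : 0 < kap m A.
  by rewrite lt_min divr_gt0//= divr_gt0// mulr_gt0// ltr_wpDl.
have km : kap m A <= m / 2 by rewrite ge_min lexx.
have kK : 68 * Csup phi 3 (m / 2) * kap m A <= A.
  have : kap m A * (68 * (Csup phi 3 (m / 2) + 1)) <= A.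
    by rewrite -ler_pdivlMr ?mulr_gt0 ?ltr_wpDl// ge_min lexx orbT.
  apply: le_trans; rewrite mulrC ler_wpM2l// ?(ltW k0)//.
  by rewrite ler_pM2l// lerDl.
split; [by rewrite divr_gt0 | by rewrite divr_gt0// mulr_gt0 |].
move=> stab cons.
apply: (qce_minimizer hphi N0 hg ymin A0 hrs k0 km kK stab).
have e0 : 0 < e by exact: eps_gt0.
set q := Num.sqrt e; have q0 : 0 < q by rewrite sqrtr_gt0.
have qq : q ^+ 2 = e by rewrite sqr_sqrtr// ltW.
move: cons; rewrite powRN powR12_sqrt ?(ltW e0)// -/q.
have -> : e `^ (3 / 2) = e * q.
  rewrite (_ : 3 / 2 = 1 + 2^-1); last by field.
  by rewrite powRD ?powRr1 ?powR12_sqrt ?(ltW e0)// gt_eqF// implybT.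
move=> /(ler_wpM2l (ltW q0)); apply: le_trans.
rewrite le_eqVlt; apply/orP; left; apply/eqP; rewrite /residual -/e -qq.
move: (norm_l2 _ _) (norm_l2 _ _) (norm_l2 _ _) (norm_l2 _ _) => n1 n2 n3 n4.
rewrite -/(C 1%N) -/(C 2%N) -/(C 3%N); move: (C 1%N) (C 2%N) (C 3%N) => c1 c2 c3.
by field; rewrite gt_eqF.
Qed.
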